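(* Let $W:\mathcal{X}\to\mathcal{S}(\mathcal{H})$ be a classical-quantum channel with $\mathcal{X}$ finite and $\mathcal{H}$ finite-dimensional, and let $\lambda_1,\lambda_2\in(0,1)$ and $\epsilon>0$ satisfy $\epsilon<1-\lambda_1-\lambda_2$. Then \[ C_{\lambda_1,\lambda_2}(W)\le R_\epsilon(W). \] Consequently, for every $0<\epsilon<1$, $C(W)\le R_\epsilon(W)$.
   Context: $\mathcal{S}(\mathcal{H})$ is the set of density matrices on $\mathcal{H}$, $\mathcal{P}(\mathcal{X})$ the set of probability distributions; logarithms base 2. For $p\in\mathcal{P}(\mathcal{X})$, $W(p)=\sum_xp(x)W_x$, $I(X;B)_{W\times p}=\sum_xp(x)D(W_x\|W(p))$ with $D(\rho\|\sigma)=\mathrm{Tr}\,\rho(\log\rho-\log\sigma)$, and $C(W):=\sup_pI(X;B)_{W\times p}$. For $x^n\in\mathcal{X}^n$, $W^{\otimes n}_{x^n}=W_{x_1}\otimes\cdots\otimes W_{x_n}$; for a distribution $p^n$ on $\mathcal{X}^n$, $W^{\otimes n}(p^n)=\sum_{x^n}p^n(x^n)W^{\otimes n}_{x^n}$. $\mathcal{P}_M(\mathcal{X}^n)$ is the set of distributions $q$ on $\mathcal{X}^n$ with $Mq(x^n)\in\mathbb{Z}$ for all $x^n$; $\varepsilon(W^{\otimes n},M):=\sup_{p^n\in\mathcal{P}(\mathcal{X}^n)}\inf_{q^n\in\mathcal{P}_M(\mathcal{X}^n)}\frac12\|W^{\otimes n}(p^n)-W^{\otimes n}(q^n)\|_1$;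 $M_\epsilon(W^{\otimes n}):=\min\{M\in\mathbb{N}_+:\varepsilon(W^{\otimes n},M)\le\epsilon\}$ and $R_\epsilon(W):=\liminf_{n\to\infty}\frac1n\log M_\epsilon(W^{\otimes n})$. An $(n,N,\lambda_1,\lambda_2)$ identification code for $W$ is a family $(p_i,D_i)_{i=1}^N$ of distributions $p_i$ on $\mathcal{X}^n$ and operators $0\le D_i\le I$ on $\mathcal{H}^{\otimes n}$ such that $\mathrm{Tr}(W^{\otimes n}(p_i)D_i)\ge1-\lambda_1$ for all $i$ and $\mathrm{Tr}(W^{\otimes n}(p_i)D_j)\le\lambda_2$ for all $i\ne j$. $N(n,\lambda_1,\lambda_2)$ is the largest $N$ for which such a code exists, and the identification capacity is $C_{\lambda_1,\lambda_2}(W):=\liminf_{n\to\infty}\frac1n\log\log N(n,\lambda_1,\lambda_2)$. *)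

(* Defs.v *)
From HB Require Import structures.
From mathcomp Require Import all_boot all_order all_algebra.
From mathcomp Require Import all_classical all_reals all_analysis.
From mathcomp Require Import complex mxtens.
Set Implicit Arguments.
Unset Strict Implicit.
Unset Printing Implicit Defensive.
Import Order.TTheory GRing.Theory Num.Theory.
Local Open Scope ring_scope.

Section QDefs.
Variable R : realType.
Local Notation C := (R[i]).

Definition adj {m n} (A : 'M[C]_(m, n)) : 'M[C]_(n, m) := (map_mx Num.conj A)^T.

Definition hermitian {d} (A : 'M[C]_d) : Prop := adj A = A.
Definition psd {d} (A : 'M[C]_d) : Prop :=
  hermitian A /\ forall v : 'rV[C]_d, 0 <= (v *m A *m adj v) 0 0.

Definition density {d} (rho : 'M[C]_d) : Prop := psd rho /\ \tr rho = 1.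

(* functional calculus f(A) := U^* diag(f(eigenvalues)) U, via the spectral
   decomposition A = invmx U *m diag_mx ev *m U of spectral.v (used for normal,
   in practice hermitian, matrices A) *)
Definition mxfun {d} (f : R -> R) (A : 'M[C]_d) : 'M[C]_d :=
  invmx (spectralmx A)
  *m diag_mx (map_mx (fun c : C => (f (complex.Re c))%:C%C) (spectral_diag A))
  *m spectralmx A.

Definition trnorm {d} (A : 'M[C]_d) : R :=
  complex.Re (\tr (mxfun Num.sqrt (adj A *m A))).

(* logarithm in base 2 (ln x = 0 for x <= 0, used only on eigenvalues in the
   support, where it does not matter) *)
Definition log2 (x : R) : R := ln x / ln 2.

Definition elog2 (x : \bar R) : \bar R :=
  match x with
  | EFin r => if (0 < r)%R then EFin (log2 r) else -oo%E
  | +oo%E => +oo%E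
  | -oo%E => -oo%E
  end.

Definition supp_sub {d} (rho sigma : 'M[C]_d) : Prop :=
  forall v : 'rV[C]_d, v *m sigma = 0 -> v *m rho = 0.

Definition relent {d} (rho sigma : 'M[C]_d) : \bar R :=
  if `[< supp_sub rho sigma >] then
    (complex.Re (\tr (rho *m (mxfun log2 rho - mxfun log2 sigma))))%:E
  else +oo%E.

Definition is_distr {T : finType} (p : T -> R) : Prop :=
  (forall x, 0 <= p x) /\ \sum_x p x = 1.

Variables (X : finType) (d : nat) (W : X -> 'M[C]_d).

Definition mixW (p : X -> R) : 'M[C]_d := \sum_x (p x)%:C%C *: W x.

Definition mutinf (p : X -> R) : \bar R :=
  (\sum_x (p x)%:E * relent (W x) (mixW p))%E.

Definition capacity : \bar R :=
  ereal_sup [set mutinf p | p in [set p : X -> R | is_distr p]].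

Fixpoint tens_word (n : nat) : n.-tuple X -> 'M[C]_(d ^ n) :=
  match n return n.-tuple X -> 'M[C]_(d ^ n) with
  | 0 => fun _ => 1%:M
  | m.+1 => fun t =>
      castmx (esym (expnS d m), esym (expnS d m))
        (W (thead t) *t tens_word (behead_tuple t))
  end.

Definition mixWn (n : nat) (p : n.-tuple X -> R) : 'M[C]_(d ^ n) :=
  \sum_x (p x)%:C%C *: tens_word x.

Definition is_Mtype (n M : nat) (q : n.-tuple X -> R) : Prop :=
  is_distr q /\ forall x, (M%:R * q x) \is a Num.int.

Definition approx_err (n M : nat) : \bar R :=
  ereal_sup [set
    ereal_inf [set ((trnorm (mixWn p - mixWn q)) / 2)%:E
              | q in [set q | is_Mtype M q]]
  | p in [set p : n.-tuple X -> R | is_distr p]].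

(* M_eps(W^{(x) n}) = min {M >= 1 : eps(W^{(x) n}, M) <= eps}  (+oo if none) *)
Definition Meps (eps : R) (n : nat) : \bar R :=
  ereal_inf [set (M%:R)%:E | M in [set M : nat | (0 < M)%N /\ (approx_err n M <= eps%:E)%E]].

Definition Reps (eps : R) : \bar R :=
  limn_einf (fun n => ((n%:R)^-1)%:E * elog2 (Meps eps n))%E.

Definition idcode (n N : nat) (l1 l2 : R) : Prop :=
  exists (p : 'I_N -> n.-tuple X -> R) (D : 'I_N -> 'M[C]_(d ^ n)),
    [/\ forall i, is_distr (p i),
        forall i, psd (D i) /\ psd (1%:M - D i),
        forall i, 1 - l1 <= complex.Re (\tr (mixWn (p i) *m D i))
      & forall i j, i != j -> complex.Re (\tr (mixWn (p i) *m D j)) <= l2].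

Definition Nid (n : nat) (l1 l2 : R) : \bar R :=
  ereal_sup [set (N%:R)%:E | N in [set N : nat | idcode n N l1 l2]].

Definition idcap (l1 l2 : R) : \bar R :=
  limn_einf (fun n => ((n%:R)^-1)%:E * elog2 (elog2 (Nid n l1 l2)))%E.

End QDefs.

(* Main.v *)
Require Import Defs.
From HB Require Import structures.
From mathcomp Require Import all_boot all_order all_algebra.
From mathcomp Require Import all_classical all_reals all_analysis.
From mathcomp Require Import complex mxtens.
From mathcomp Require Import ring lra zify.
Import Order.TTheory GRing.Theory Num.Theory.
Set Implicit Arguments.
Unset Strict Implicit.
Unset Printing Implicit Defensive.
Local Open Scope ring_scope.

(** Both inequalities go through the capacity [C(W)]: the identification capacity is at
    most [C(W)] whenever [l1 + l2 < 1], and [C(W) <= Reps W eps] for every [eps < 1].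
    (Mapping codewords to approximating M-types and comparing two codewords with the
    same M-type would only give the first claim for [2 * eps < 1 - l1 - l2].)

    Lower bound on resolvability.  A greedy (Feinstein-Winter) code of [L * B] words
    with decoding operators [E (l, b)] yields, for each [f : [L] -> [B]], the uniform
    input on the words [(l, f l)].  If all these inputs are [eps]-close to M-types and
    there are many more functions than M-types, then some M-type [q] is shared by [m]
    functions that pairwise agree on few positions.  Their decoding tests restricted to
    the positions without agreement are disjoint, so their probabilities under [q] add
    up to at most 1, although each is about [1 - eps] or more: impossible for large [m].

    Identification converse.  A word [x] of type [P] is replaced by an operator
    truncated to the large eigenvalues of a tensor power of [sigma], a slightly smoothed
    version of [W(P)], and to the small eigenvalues of the word state.  In the Hilbert
    norm weighted by [sigma^-1] its square is at most [exp (n (C + o(1)))], so sampling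
    that many words approximates every output simultaneously for all tests, and two
    codewords with the same sample would violate [l1 + l2 < 1].  Tails are controlled by
    moment generating functions, which are multiplicative over tensor products. *)

(** * Traces, positive semidefinite matrices and effects *)

Section Matrices.
Variable R : realType.
Local Notation C := (R[i]).

Definition retr n (A : 'M[C]_n) : R := complex.Re (\tr A).

Lemma ReD (x y : C) : complex.Re (x + y) = complex.Re x + complex.Re y.
Proof. by case: x; case: y. Qed.

Lemma ReN (x : C) : complex.Re (- x) = - complex.Re x.
Proof. by case: x. Qed.

Lemma Re_sum (I : Type) (s : seq I) (P : pred I) (F : I -> C) :
  complex.Re (\sum_(i <- s | P i) F i) = \sum_(i <- s | P i) complex.Re (F i).
Proof. by apply: (big_morph _ ReD). Qed.

Lemma ReZ (c : R) (x : C) : complex.Re (c%:C%C * x) = c * complex.Re x.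
Proof. by case: x => a b /=; rewrite mul0r subr0. Qed.

Lemma conj_realC (c : R) : Num.conj (c%:C%C : C) = c%:C%C.
Proof. by rewrite conj_Creal // complex_real. Qed.

Lemma ge0_Re (x : C) : 0 <= x -> 0 <= complex.Re x.
Proof. by rewrite lecE /= => /andP[]. Qed.

Lemma ge0_ReK (x : C) : 0 <= x -> x = (complex.Re x)%:C%C.
Proof. by case: x => a b; rewrite lecE /= => /andP[/eqP -> _]. Qed.

Lemma ge0_realC (c : R) : 0 <= c -> (0 : C) <= c%:C%C.
Proof. by rewrite lecR. Qed.

Lemma realCD (a b : R) : (a + b)%:C%C = a%:C%C + b%:C%C :> C.
Proof. exact: rmorphD. Qed.

Lemma realCM (a b : R) : (a * b)%:C%C = a%:C%C * b%:C%C :> C.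
Proof. exact: rmorphM. Qed.

(** * Adjoints and real traces *)

Lemma adjE m n (A : 'M[C]_(m, n)) i j : adj A i j = Num.conj (A j i).
Proof. by rewrite !mxE. Qed.

Lemma adjM m n p (A : 'M[C]_(m, n)) (B : 'M[C]_(n, p)) :
  adj (A *m B) = adj B *m adj A.
Proof. by rewrite /adj map_mxM trmx_mul. Qed.

Lemma adjK m n (A : 'M[C]_(m, n)) : adj (adj A) = A.
Proof. by apply/matrixP => i j; rewrite !adjE conjCK. Qed.

Lemma adjD m n (A B : 'M[C]_(m, n)) : adj (A + B) = adj A + adj B.
Proof. by apply/matrixP => i j; rewrite !(adjE, mxE) rmorphD. Qed.

Lemma adjN m n (A : 'M[C]_(m, n)) : adj (- A) = - adj A.
Proof. by apply/matrixP => i j; rewrite !(adjE, mxE) rmorphN. Qed.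

Lemma adjB m n (A B : 'M[C]_(m, n)) : adj (A - B) = adj A - adj B.
Proof. by rewrite adjD adjN. Qed.

Lemma adjZ m n (c : R) (A : 'M[C]_(m, n)) : adj (c%:C%C *: A) = c%:C%C *: adj A.
Proof. by apply/matrixP => i j; rewrite !(adjE, mxE) rmorphM /= conj_realC. Qed.

Lemma adj0 m n : adj (0 : 'M[C]_(m, n)) = 0.
Proof. by apply/matrixP => i j; rewrite !(adjE, mxE) rmorph0. Qed.

Lemma adj_scalar1 n : adj (1%:M : 'M[C]_n) = 1%:M.
Proof. by apply/matrixP => i j; rewrite !(adjE, mxE) rmorph_nat eq_sym. Qed.

Lemma retrD n (A B : 'M[C]_n) : retr (A + B) = retr A + retr B.
Proof. by rewrite /retr mxtraceD ReD. Qed.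

Lemma retrN n (A : 'M[C]_n) : retr (- A) = - retr A.
Proof. by rewrite /retr -scaleN1r mxtraceZ mulN1r ReN. Qed.

Lemma retrB n (A B : 'M[C]_n) : retr (A - B) = retr A - retr B.
Proof. by rewrite retrD retrN. Qed.

Lemma retrZ n (c : R) (A : 'M[C]_n) : retr (c%:C%C *: A) = c * retr A.
Proof. by rewrite /retr mxtraceZ ReZ. Qed.

Lemma retr0 n : retr (0 : 'M[C]_n) = 0.
Proof. by rewrite /retr mxtrace0. Qed.

Lemma retr_sum n (I : Type) (s : seq I) (P : pred I) (F : I -> 'M[C]_n) :
  retr (\sum_(i <- s | P i) F i) = \sum_(i <- s | P i) retr (F i).
Proof. by apply: (big_morph _ (@retrD n)); rewrite retr0. Qed.

Lemma retrC m n (A : 'M[C]_(m, n)) (B : 'M[C]_(n, m)) : retr (A *m B) = retr (B *m A).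
Proof. by rewrite /retr mxtrace_mulC. Qed.

Lemma retr_adj n (A : 'M[C]_n) : retr (adj A) = retr A.
Proof.
rewrite /retr /mxtrace !Re_sum; apply: eq_bigr => i _; rewrite adjE.
by case: (A i i).
Qed.

Lemma retr_mulmx_adj m n (A : 'M[C]_(m, n)) :
  retr (A *m adj A) =
  \sum_i \sum_j ((complex.Re (A i j)) ^+ 2 + (complex.Im (A i j)) ^+ 2).
Proof.
rewrite /retr /mxtrace Re_sum; apply: eq_bigr => i _.
rewrite mxE Re_sum; apply: eq_bigr => j _; rewrite adjE.
by case: (A i j) => a b /=; ring.
Qed.

Lemma retr_mulmx_adj_ge0 m n (A : 'M[C]_(m, n)) : 0 <= retr (A *m adj A).
Proof.
rewrite retr_mulmx_adj; apply: sumr_ge0 => i _; apply: sumr_ge0 => j _.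
by rewrite addr_ge0 // sqr_ge0.
Qed.

(* Cauchy-Schwarz for the Hilbert-Schmidt product, in the form given by AM-GM *)
Lemma retr_mulmx_le m n (A : 'M[C]_(m, n)) (B : 'M[C]_(n, m)) (e : R) :
  0 < e -> retr (A *m adj A) <= e ^+ 2 -> retr (B *m adj B) <= 1 ->
  `|retr (A *m B)| <= e.
Proof.
move=> e0 hA hB.
have hBA : retr (adj B *m adj A) = retr (A *m B) by rewrite -adjM retr_adj.
have hBB : retr (adj B *m B) <= 1 by rewrite retrC.
(* Both squared norms [|A + e B^*|^2] and [|A - e B^*|^2] are nonnegative; expanded, they bound
   [2 e Re Tr (A B)] by [2 e ^ 2] on either side. *)
have := retr_mulmx_adj_ge0 (A + (e%:C%C : C) *: adj B).
have := retr_mulmx_adj_ge0 (A - (e%:C%C : C) *: adj B).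
rewrite !(adjD, adjN, adjZ, adjK) !(mulmxDl, mulmxDr, mulNmx, mulmxN).
rewrite -!(scalemxAl, scalemxAr) !(retrD, retrN, retrZ) !hBA => h1 h2.
rewrite ler_norml; apply/andP; split; rewrite -(ler_pM2r e0); nra.
Qed.

(** * Positive semidefinite matrices *)

Lemma psd_herm n (A : 'M[C]_n) : psd A -> adj A = A.
Proof. by case. Qed.

Lemma psdD n (A B : 'M[C]_n) : psd A -> psd B -> psd (A + B).
Proof.
move=> [hA pA] [hB pB]; split; first by rewrite /Defs.hermitian adjD hA hB.
by move=> v; rewrite mulmxDr mulmxDl mxE addr_ge0.
Qed.

Lemma psd0 n : psd (0 : 'M[C]_n).
Proof. by split=> [|v]; rewrite /Defs.hermitian ?adj0 // mulmx0 mul0mx mxE. Qed.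

Lemma psd_sum n (I : Type) (s : seq I) (P : pred I) (F : I -> 'M[C]_n) :
  (forall i, P i -> psd (F i)) -> psd (\sum_(i <- s | P i) F i).
Proof. by move=> h; elim/big_ind: _ => //; [apply: psd0|apply: psdD]. Qed.

Lemma psdZ n (c : R) (A : 'M[C]_n) : 0 <= c -> psd A -> psd (c%:C%C *: A).
Proof.
move=> c0 [hA pA]; split; first by rewrite /Defs.hermitian adjZ hA.
by move=> v; rewrite -scalemxAr -scalemxAl mxE mulr_ge0 // ge0_realC.
Qed.

Lemma psd_conj m n (A : 'M[C]_n) (B : 'M[C]_(n, m)) :
  psd A -> psd (adj B *m A *m B).
Proof.
move=> [hA pA]; split; first by rewrite /Defs.hermitian !adjM adjK hA mulmxA.
by move=> v; have := pA (v *m adj B); rewrite adjM adjK !mulmxA.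
Qed.

Lemma psd_conjr m n (A : 'M[C]_n) (B : 'M[C]_(m, n)) :
  psd A -> psd (B *m A *m adj B).
Proof. by move=> /(psd_conj (adj B)); rewrite adjK. Qed.

Lemma psd1 n : psd (1%:M : 'M[C]_n).
Proof.
split=> [|v]; first exact: adj_scalar1.
rewrite mulmx1 mxE; apply: sumr_ge0 => i _.
by rewrite adjE mul_conjC_ge0.
Qed.

Lemma psd_mulmx_adj m n (B : 'M[C]_(m, n)) : psd (B *m adj B).
Proof. by have := psd_conjr B (psd1 n); rewrite mulmx1. Qed.

Lemma psd_diag_ge0 n (A : 'M[C]_n) i : psd A -> 0 <= A i i.
Proof.
move=> [_ /(_ (delta_mx 0 i))].
rewrite -rowE mxE (bigD1 i) //= big1 ?addr0; last first.
  by move=> j ji; rewrite adjE !mxE (negbTE ji) andbF rmorph0 mulr0.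
by rewrite adjE !mxE !eqxx rmorph1 mulr1.
Qed.

Lemma psd_retr_ge0 n (A : 'M[C]_n) : psd A -> 0 <= retr A.
Proof.
move=> pA; rewrite /retr Re_sum; apply: sumr_ge0 => i _.
exact/ge0_Re/psd_diag_ge0.
Qed.

Lemma density_psd n (A : 'M[C]_n) : density A -> psd A.
Proof. by case. Qed.

Lemma density_tr n (A : 'M[C]_n) : density A -> \tr A = 1.
Proof. by case. Qed.

Lemma density_retr n (A : 'M[C]_n) : density A -> retr A = 1.
Proof. by move=> /density_tr; rewrite /retr => ->. Qed.

(** * Diagonalisation in a unitary basis *)

Definition unitary n (U : 'M[C]_n) := U *m adj U = 1%:M.

Lemma unitaryV n (U : 'M[C]_n) : unitary U -> adj U *m U = 1%:M.
Proof. exact: mulmx1C. Qed.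

(** The hermitian matrix with real eigenvalues [r] in the orthonormal basis given by the rows of
    [U]. Functional calculus, states and projections are all put in this form, so that matrices
    sharing a basis compare eigenvalue by eigenvalue. *)
Definition hdiag n (U : 'M[C]_n) (r : 'I_n -> R) : 'M[C]_n :=
  adj U *m diag_mx (\row_i (r i)%:C%C) *m U.

Lemma adj_diag n (r : 'I_n -> R) :
  adj (diag_mx (\row_i (r i)%:C%C) : 'M[C]_n) = diag_mx (\row_i (r i)%:C%C).
Proof.
apply/matrixP => i j; rewrite adjE !mxE eq_sym.
by case: eqP => [->|_]; rewrite ?mulr1n ?conj_realC // mulr0n rmorph0.
Qed.

Lemma diag_psd n (r : 'I_n -> R) : (forall i, 0 <= r i) ->
  psd (diag_mx (\row_i (r i)%:C%C) : 'M[C]_n).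
Proof.
move=> r0; split; first exact: adj_diag.
move=> v; rewrite mxE; apply: sumr_ge0 => i _.
rewrite mul_mx_diag adjE !mxE mulrAC mulr_ge0 ?mul_conjC_ge0 //.
exact: ge0_realC.
Qed.

Lemma hdiag_psd n (U : 'M[C]_n) r : (forall i, 0 <= r i) -> psd (hdiag U r).
Proof. by move=> r0; apply/psd_conj/diag_psd. Qed.

Lemma hdiag_herm n (U : 'M[C]_n) r : adj (hdiag U r) = hdiag U r.
Proof. by rewrite /hdiag !adjM adjK adj_diag mulmxA. Qed.

Lemma eq_hdiag n (U : 'M[C]_n) r r' : r =1 r' -> hdiag U r = hdiag U r'.
Proof. by move=> /funext ->. Qed.

Lemma hdiagM n (U : 'M[C]_n) r r' : unitary U ->
  hdiag U r *m hdiag U r' = hdiag U (fun i => r i * r' i).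
Proof.
move=> uU; rewrite /hdiag !mulmxA -[X in X *m _ *m _](mulmxA) uU mulmx1.
rewrite -[X in X *m U](mulmxA) mulmx_diag; congr (_ *m diag_mx _ *m _).
by apply/rowP => i; rewrite !mxE realCM.
Qed.

Lemma hdiagB n (U : 'M[C]_n) r r' :
  hdiag U r - hdiag U r' = hdiag U (fun i => r i - r' i).
Proof.
rewrite /hdiag -mulmxBl -mulmxBr -raddfB; congr (_ *m diag_mx _ *m _).
by apply/rowP => i; rewrite !mxE rmorphB.
Qed.

Lemma hdiagD n (U : 'M[C]_n) r r' :
  hdiag U r + hdiag U r' = hdiag U (fun i => r i + r' i).
Proof.
rewrite /hdiag -mulmxDl -mulmxDr -raddfD; congr (_ *m diag_mx _ *m _).
by apply/rowP => i; rewrite !mxE realCD.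
Qed.

Lemma hdiagZ n (U : 'M[C]_n) c r :
  c%:C%C *: hdiag U r = hdiag U (fun i => c * r i).
Proof.
rewrite /hdiag scalemxAl scalemxAr -linearZ; congr (_ *m diag_mx _ *m _).
by apply/rowP => i; rewrite !mxE realCM.
Qed.

Lemma hdiag1 n (U : 'M[C]_n) : unitary U -> hdiag U (fun=> 1) = 1%:M.
Proof.
move=> /unitaryV uU; rewrite /hdiag (_ : diag_mx _ = 1%:M) ?mulmx1 //.
by rewrite -diag_const_mx; f_equal; apply/rowP => i; rewrite !mxE.
Qed.

Lemma mul_diag_mxE n (r : 'rV[C]_n) (A : 'M[C]_n) i j :
  (diag_mx r *m A) i j = r 0 i * A i j.
Proof. by rewrite mul_diag_mx mxE. Qed.

Lemma tr_hdiag_mul n (U A : 'M[C]_n) r :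
  \tr (hdiag U r *m A) = \sum_i (r i)%:C%C * (U *m A *m adj U) i i.
Proof.
have -> : hdiag U r *m A = adj U *m (diag_mx (\row_i (r i)%:C%C) *m (U *m A)).
  by rewrite /hdiag !mulmxA.
rewrite mxtrace_mulC -(mulmxA _ (U *m A)); apply: eq_bigr => i _.
by rewrite mul_diag_mxE mxE.
Qed.

Lemma tr_hdiag n (U : 'M[C]_n) r : unitary U -> \tr (hdiag U r) = (\sum_i r i)%:C%C.
Proof.
move=> uU; rewrite -[hdiag U r]mulmx1 tr_hdiag_mul mulmx1 uU rmorph_sum.
by apply: eq_bigr => i _; rewrite mxE eqxx mulr1.
Qed.

Lemma retr_hdiag n (U : 'M[C]_n) r : unitary U -> retr (hdiag U r) = \sum_i r i.
Proof. by move=> uU; rewrite /retr tr_hdiag. Qed.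

Definition spec n (A : 'M[C]_n) (i : 'I_n) : R := complex.Re (spectral_diag A 0 i).

Lemma trC_adj m n (A : 'M[C]_(m, n)) : map_mx Num.conj A^T = adj A.
Proof. by rewrite /adj map_trmx. Qed.

Lemma spectral_unitary n (A : 'M[C]_n) : unitary (spectralmx A).
Proof. by have /unitarymxP := spectral_unitarymx A; rewrite trC_adj. Qed.

Lemma mxfunE n f (A : 'M[C]_n) :
  mxfun f A = hdiag (spectralmx A) (fun i => f (spec A i)).
Proof.
rewrite /mxfun /hdiag (invmx_unitary (spectral_unitarymx A)) trC_adj; congr (_ *m diag_mx _ *m _).
by apply/rowP => i; rewrite !mxE.
Qed.

Lemma hermitian_hdiag n (A : 'M[C]_n) : Defs.hermitian A ->
  A = hdiag (spectralmx A) (spec A).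
Proof.
move=> hA; have hs : A \is hermsymmx.
  apply/is_hermitianmxP; rewrite expr0 scale1r.
  by rewrite -{1}hA /adj map_trmx.
have /orthomx_spectralP {1}-> := hermitian_normalmx hs.
rewrite /hdiag (invmx_unitary (spectral_unitarymx A)) trC_adj; congr (_ *m diag_mx _ *m _).
apply/rowP => i; rewrite mxE /spec RRe_real //.
by have /mxOverP := hermitian_spectral_diag_real hs; apply.
Qed.

Lemma hdiag_conj n (U : 'M[C]_n) r : unitary U ->
  U *m hdiag U r *m adj U = diag_mx (\row_i (r i)%:C%C).
Proof.
move=> uU; rewrite /hdiag !mulmxA uU mul1mx -mulmxA.
by rewrite (_ : U *m adj U = 1%:M) ?mulmx1.
Qed.

Lemma spec_ge0 n (A : 'M[C]_n) i : psd A -> 0 <= spec A i.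
Proof.
move=> pA; have hA := hermitian_hdiag (psd_herm pA).
have := psd_diag_ge0 i (psd_conjr (spectralmx A) pA).
rewrite {2}hA hdiag_conj; last exact: spectral_unitary.
by rewrite !mxE eqxx mulr1n lecR.
Qed.

Lemma tr_hdiag_psd n (U A : 'M[C]_n) r : psd A ->
  \tr (hdiag U r *m A) = (\sum_i r i * complex.Re ((U *m A *m adj U) i i))%:C%C.
Proof.
move=> pA; rewrite tr_hdiag_mul rmorph_sum; apply: eq_bigr => i _.
by rewrite rmorphM /= {1}(ge0_ReK (psd_diag_ge0 i (psd_conjr U pA))).
Qed.

(** In an eigenbasis of [A] the trace is a sum of eigenvalues of [A] times diagonal entries of the
    rotated [B], all nonnegative. *)
Lemma retr_mul_ge0 n (A B : 'M[C]_n) : psd A -> psd B -> 0 <= retr (A *m B).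
Proof.
move=> pA pB; rewrite {1}(hermitian_hdiag (psd_herm pA)) /retr tr_hdiag_psd //=.
apply: sumr_ge0 => i _; apply: mulr_ge0; first exact: spec_ge0.
exact/ge0_Re/psd_diag_ge0/psd_conjr.
Qed.

Lemma retr_mul_le n (A B D : 'M[C]_n) : psd A -> psd (D - B) ->
  retr (A *m B) <= retr (A *m D).
Proof. by move=> pA pB; rewrite -subr_ge0 -retrB -mulmxBr retr_mul_ge0. Qed.

Lemma psd_spectral n (A : 'M[C]_n) : psd A ->
  exists U r, [/\ unitary U, forall i, 0 <= r i & A = hdiag U r].
Proof.
move=> pA; exists (spectralmx A), (spec A); split=> [|i|].
- exact: spectral_unitary.
- exact: spec_ge0.
- exact/hermitian_hdiag/psd_herm.
Qed.

Lemma psd_sqrt n (A : 'M[C]_n) : psd A -> exists2 Q, psd Q & Q *m Q = A.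
Proof.
move=> /psd_spectral[U [r [uU r0 ->]]].
exists (hdiag U (fun i => Num.sqrt (r i))).
  by apply: hdiag_psd => i; apply: sqrtr_ge0.
by rewrite hdiagM //; apply: eq_hdiag => i; rewrite -expr2 sqr_sqrtr.
Qed.

(** On [[0, 1]] the square root dominates the identity; the resulting inequality [A <= Q] is what
    the gentle operator argument uses. *)
Lemma effect_sqrt n (A : 'M[C]_n) : psd A -> psd (1%:M - A) ->
  exists Q, [/\ psd Q, Q *m Q = A & psd (Q - A)].
Proof.
move=> /psd_spectral[U [r [uU r0 ->]]] p1A.
have r1 i : r i <= 1.
  have := psd_diag_ge0 i (psd_conjr U p1A).
  rewrite mulmxBr mulmxBl mulmx1 uU hdiag_conj // !mxE eqxx mulr1n subr_ge0.
  by rewrite -lecR.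
exists (hdiag U (fun i => Num.sqrt (r i))); split.
- by apply: hdiag_psd => i; apply: sqrtr_ge0.
- by rewrite hdiagM //; apply: eq_hdiag => i; rewrite -expr2 sqr_sqrtr.
- rewrite hdiagB; apply: hdiag_psd => i; rewrite subr_ge0.
  rewrite -{1}(sqr_sqrtr (r0 i)) expr2 ler_piMl ?sqrtr_ge0 //.
  by rewrite -sqrtr1 ler_wsqrtr.
Qed.

(** The identity [D - D D = D (1 - D) D + (1 - D) D (1 - D)] exhibits the difference as a sum of two
    conjugates of positive matrices. *)
Lemma effect_sqr n (D : 'M[C]_n) : psd D -> psd (1%:M - D) -> psd (D - D *m D).
Proof.
move=> pD p1D.
have -> : D - D *m D = adj D *m (1%:M - D) *m D +
                       adj (1%:M - D) *m D *m (1%:M - D).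
  have DC : (1%:M - D) *m D = D *m (1%:M - D).
    by rewrite mulmxBl mulmxBr mulmx1 mul1mx.
  rewrite adjB adj_scalar1 (psd_herm pD) DC -mulmxDr (addrC D (1%:M - D)) subrK mulmx1.
  by rewrite mulmxBr mulmx1.
by apply: psdD; apply: psd_conj.
Qed.

Lemma effect_sqr_le1 n (D : 'M[C]_n) : psd D -> psd (1%:M - D) ->
  psd (1%:M - D *m D).
Proof.
move=> pD p1D; have := psdD p1D (effect_sqr pD p1D).
by rewrite addrA subrK.
Qed.

Lemma retr_mul_le_tr n (A D : 'M[C]_n) : psd A -> psd (1%:M - D) ->
  retr (A *m D) <= retr A.
Proof. by move=> pA /(retr_mul_le pA); rewrite mulmx1. Qed.

(* Cauchy-Schwarz for the form [(A, B) |-> Tr (A* W B)] *)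
Lemma retr_weighted_le n (W A B : 'M[C]_n) (e : R) : psd W -> 0 < e ->
  retr (W *m (A *m adj A)) <= e ^+ 2 -> retr (W *m (adj B *m B)) <= 1 ->
  `|retr (W *m A *m B)| <= e.
Proof.
move=> pW e0 hA hB; have [Q pQ QW] := psd_sqrt pW.
(* Splitting [W = Q Q] reduces the weighted form to the Hilbert-Schmidt product of [Q A] and
   [B Q]. *)
have := @retr_mulmx_le _ _ (Q *m A) (B *m Q) e e0.
rewrite !adjM (psd_herm pQ) => h.
have -> : W *m A *m B = Q *m (Q *m A *m B) by rewrite -QW !mulmxA.
rewrite retrC -[_ *m Q]mulmxA; apply: h.
  by rewrite mulmxA retrC !mulmxA QW -mulmxA.
by rewrite -mulmxA (mulmxA Q) QW retrC -mulmxA.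
Qed.

End Matrices.

(** * Tensor products of words of matrices *)

Section SquareCast.
Variable R : realType.
Local Notation C := (R[i]).

Lemma castmx_sqM m n (e : m = n) (A B : 'M[C]_m) :
  castmx (e, e) A *m castmx (e, e) B = castmx (e, e) (A *m B).
Proof. by case: n / e. Qed.

Lemma castmx_sq_adj m n (e : m = n) (A : 'M[C]_m) :
  adj (castmx (e, e) A) = castmx (e, e) (adj A).
Proof. by case: n / e. Qed.

Lemma castmx_sq1 m n (e : m = n) : castmx (e, e) (1%:M : 'M[C]_m) = 1%:M.
Proof. by case: n / e. Qed.

Lemma castmx_sq_tr m n (e : m = n) (A : 'M[C]_m) : \tr (castmx (e, e) A) = \tr A.
Proof. by case: n / e. Qed.

Lemma castmx_sqZ m n (e : m = n) c (A : 'M[C]_m) :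
  castmx (e, e) (c *: A) = c *: castmx (e, e) A.
Proof. by case: n / e. Qed.

Lemma castmx_sq_sum m n (e : m = n) (I : finType) (F : I -> 'M[C]_m) :
  castmx (e, e) (\sum_i F i) = \sum_i castmx (e, e) (F i).
Proof. by case: n / e; apply: eq_bigr. Qed.

Lemma castmx_sq_diag m n (e : m = n) (r : 'I_m -> C) :
  castmx (e, e) (diag_mx (\row_i r i)) = diag_mx (\row_i r (cast_ord (esym e) i)).
Proof.
case: n / e; rewrite castmx_id; congr diag_mx; apply/rowP => i; rewrite !mxE.
by congr r; apply: val_inj.
Qed.

Lemma adj_tens m n (A : 'M[C]_m) (B : 'M[C]_n) : adj (A *t B) = adj A *t adj B.
Proof. by rewrite /adj map_mxT trmx_tens. Qed.

Lemma tr_tens m n (A : 'M[C]_m) (B : 'M[C]_n) : \tr (A *t B) = \tr A * \tr B.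
Proof. by rewrite /mxtrace mulr_sum; apply: eq_bigr => i _; rewrite mxE. Qed.

Lemma tens_diag m n (r : 'I_m -> C) (s : 'I_n -> C) :
  diag_mx (\row_i r i) *t diag_mx (\row_i s i) =
  diag_mx (\row_i (r (mxtens_unindex i).1 * s (mxtens_unindex i).2)).
Proof.
apply/matrixP => i j; rewrite !mxE.
have [->|nij] := eqVneq i j; first by rewrite !eqxx !mulr1n.
rewrite mulr0n; have [e1|] := eqVneq (mxtens_unindex i).1 (mxtens_unindex j).1;
  last by rewrite mulr0n mul0r.
have [e2|] := eqVneq (mxtens_unindex i).2 (mxtens_unindex j).2;
  last by rewrite mulr0n mulr0.
case/eqP: nij; apply: (can_inj (@mxtens_unindexK m n)).
by rewrite [LHS]surjective_pairing [RHS]surjective_pairing e1 e2.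
Qed.

Lemma tens_1 m n : (1%:M : 'M[C]_m) *t (1%:M : 'M[C]_n) = 1%:M.
Proof.
have e k : (1%:M : 'M[C]_k) = diag_mx (\row_i 1).
  by rewrite -diag_const_mx; congr diag_mx; apply/rowP => i; rewrite !mxE.
by rewrite !e tens_diag mulr1.
Qed.

Lemma tens_suml m n (I : finType) (F : I -> 'M[C]_m) (B : 'M[C]_n) :
  (\sum_i F i) *t B = \sum_i F i *t B.
Proof.
apply/matrixP => i j; rewrite !mxE !summxE mulr_suml.
by apply: eq_bigr => k _; rewrite mxE.
Qed.

Lemma tens_sumr m n (I : finType) (A : 'M[C]_m) (F : I -> 'M[C]_n) :
  A *t (\sum_i F i) = \sum_i A *t F i.
Proof.
apply/matrixP => i j; rewrite !mxE !summxE mulr_sumr.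
by apply: eq_bigr => k _; rewrite mxE.
Qed.

End SquareCast.

(** * Words as tensor products and their spectra *)

Section TensorWords.
Variables (R : realType) (X : finType) (d : nat).
Local Notation C := (R[i]).
Implicit Types (V : X -> 'M[C]_d) (r g : X -> 'I_d -> R).

Lemma eq_tens_word V V' n (t : n.-tuple X) : V =1 V' -> tens_word V t = tens_word V' t.
Proof. by move=> /funext ->. Qed.

Lemma tens_wordM V V' n (t : n.-tuple X) :
  tens_word V t *m tens_word V' t = tens_word (fun x => V x *m V' x) t.
Proof.
elim: n t => [|n IH] t /=; first by rewrite mulmx1.
by rewrite castmx_sqM tensmx_mul IH.
Qed.

Lemma tens_word_adj V n (t : n.-tuple X) :
  adj (tens_word V t) = tens_word (fun x => adj (V x)) t.
Proof.
elim: n t => [|n IH] t; first exact: adj_scalar1.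
by rewrite /= castmx_sq_adj adj_tens IH.
Qed.

Lemma tens_word1 n (t : n.-tuple X) : tens_word (fun=> 1%:M : 'M[C]_d) t = 1%:M.
Proof.
elim: n t => [|n IH] t //=.
by rewrite IH tens_1 castmx_sq1.
Qed.

Lemma tuple_prodS (K : comPzRingType) (f : X -> K) n (t : n.+1.-tuple X) :
  \prod_(x <- t) f x = f (thead t) * \prod_(x <- behead_tuple t) f x.
Proof. by case/tupleP: t => x t; rewrite big_cons theadE; congr (_ * _). Qed.

Lemma tens_word_tr V n (t : n.-tuple X) :
  \tr (tens_word V t) = \prod_(x <- t) \tr (V x).
Proof.
elim: n t => [|n IH] t; first by rewrite tuple0 big_nil /= mxtrace1.
by rewrite tuple_prodS -IH /= castmx_sq_tr tr_tens.
Qed.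

Lemma tens_wordZ (c : X -> R) V n (t : n.-tuple X) :
  tens_word (fun x => (c x)%:C%C *: V x) t =
  (\prod_(x <- t) c x)%:C%C *: tens_word V t.
Proof.
elim: n t => [|n IH] t; first by rewrite tuple0 big_nil /= scale1r.
rewrite tuple_prodS /= IH -castmx_sqZ; congr castmx.
by apply/matrixP => i j; rewrite !mxE rmorphM /=; ring.
Qed.

(** The product spectrum of a word: the index is split factor by factor in the order used by
    [tens_word], and the entry is the product of the [r x] along the letters. *)
Fixpoint trow r n : n.-tuple X -> 'I_(d ^ n) -> R :=
  match n return n.-tuple X -> 'I_(d ^ n) -> R with
  | 0 => fun _ _ => 1
  | m.+1 => fun t i =>
      let ij := mxtens_unindex (cast_ord (expnS d m) i) in
      r (thead t) ij.1 * trow r (behead_tuple t) ij.2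
  end.

Lemma tens_word_diag r n (t : n.-tuple X) :
  tens_word (fun x => diag_mx (\row_i (r x i)%:C%C) : 'M[C]_d) t =
  diag_mx (\row_i (trow r t i)%:C%C).
Proof.
elim: n t => [|n IH] t /=.
  by rewrite -diag_const_mx; congr diag_mx; apply/rowP => i; rewrite !mxE.
rewrite IH tens_diag castmx_sq_diag; congr diag_mx; apply/rowP => i.
by rewrite !mxE esymK rmorphM.
Qed.

Lemma tens_word_hdiag (U : X -> 'M[C]_d) r n (t : n.-tuple X) :
  tens_word (fun x => hdiag (U x) (r x)) t = hdiag (tens_word U t) (trow r t).
Proof. by rewrite /hdiag tens_word_adj -tens_word_diag !tens_wordM. Qed.

Lemma tens_word_unitary (U : X -> 'M[C]_d) n (t : n.-tuple X) :
  (forall x, unitary (U x)) -> unitary (tens_word U t).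
Proof.
move=> uU; rewrite /unitary tens_word_adj tens_wordM -(tens_word1 t).
by apply: eq_tens_word => x; apply: uU.
Qed.

Lemma trow_ge0 r n (t : n.-tuple X) i : (forall x j, 0 <= r x j) -> 0 <= trow r t i.
Proof. by move=> r0; elim: n t i => [|n IH] t i //=; rewrite mulr_ge0. Qed.

Lemma trow_gt0 r n (t : n.-tuple X) i : (forall x j, 0 < r x j) -> 0 < trow r t i.
Proof. by move=> r0; elim: n t i => [|n IH] t i //=; rewrite mulr_gt0. Qed.

(** The power [w ^ (1 + s)] is written [w * expR (s * ln w)]: the factor [w] makes both sides vanish
    at zero eigenvalues, where [ln] has only its default value. The version without this factor
    needs positive [r]. *)
Lemma trow_powM r s n (t : n.-tuple X) i : (forall x j, 0 <= r x j) ->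
  trow (fun x j => r x j * expR (s * ln (r x j))) t i =
  trow r t i * expR (s * ln (trow r t i)).
Proof.
move=> r0; elim: n t i => [|n IH] t i /=; first by rewrite ln1 mulr0 expR0 mulr1.
rewrite IH; set a := r _ _; set b := trow _ _ _.
have [->|an0] := eqVneq a 0; first by rewrite !mul0r.
have [->|bn0] := eqVneq b 0; first by rewrite !(mul0r, mulr0).
have a0 : 0 < a by rewrite lt0r an0 r0.
have b0 : 0 < b by rewrite lt0r bn0 trow_ge0.
by rewrite lnM ?posrE // mulrDr expRD mulrACA.
Qed.

Lemma trow_pow r s n (t : n.-tuple X) i : (forall x j, 0 < r x j) ->
  trow (fun x j => expR (s * ln (r x j))) t i = expR (s * ln (trow r t i)).
Proof.
move=> r0; elim: n t i => [|n IH] t i /=; first by rewrite ln1 mulr0 expR0.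
by rewrite IH lnM ?posrE // ?trow_gt0 // mulrDr expRD.
Qed.

Lemma tens_word_psd V n (t : n.-tuple X) :
  (forall x, psd (V x)) -> psd (tens_word V t).
Proof.
move=> pV; have -> : tens_word V t =
    tens_word (fun x => hdiag (spectralmx (V x)) (spec (V x))) t.
  by apply: eq_tens_word => x; apply/hermitian_hdiag/psd_herm/pV.
by rewrite tens_word_hdiag; apply: hdiag_psd => i; apply: trow_ge0 => *; apply: spec_ge0.
Qed.

Lemma tens_word_density V n (t : n.-tuple X) :
  (forall x, density (V x)) -> density (tens_word V t).
Proof.
move=> dV; split; first by apply: tens_word_psd => x; apply: density_psd.
by rewrite tens_word_tr big1 // => x _; apply: density_tr.
Qed.

Lemma sum_tupleS (K : nmodType) n (F : X -> n.-tuple X -> K) :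
  \sum_(t : n.+1.-tuple X) F (thead t) (behead_tuple t) =
  \sum_x \sum_(t : n.-tuple X) F x t.
Proof.
rewrite pair_big /= (reindex (fun p : X * n.-tuple X => [tuple of p.1 :: p.2])) /=.
  apply: eq_bigr => -[x t] _ /=; rewrite theadE; congr F; exact: val_inj.
exists (fun t : n.+1.-tuple X => (thead t, behead_tuple t)) => [[x t]|t] _ /=.
  by rewrite theadE; congr pair; apply: val_inj.
by rewrite [RHS]tuple_eta.
Qed.

(** Distributivity of the tensor product over sums. The right-hand side is an [n]-fold tensor power,
    written as a word along [t0]. *)
Lemma sum_tens_word V n (t0 : n.-tuple X) :
  \sum_(t : n.-tuple X) tens_word V t = tens_word (fun=> \sum_x V x) t0.
Proof.
elim: n t0 => [|n IH] t0.
  rewrite (bigD1 t0) //= big1 ?addr0 // => t.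
  by rewrite (tuple0 t) (tuple0 t0) eqxx.
rewrite /= -(IH (behead_tuple t0)) tens_suml castmx_sq_sum.
rewrite (@sum_tupleS _ n (fun x t =>
  castmx (esym (expnS d n), esym (expnS d n)) (V x *t tens_word V t))).
by apply: eq_bigr => x _; rewrite tens_sumr castmx_sq_sum.
Qed.

End TensorWords.

(** * Trace norm and one-shot codes *)

Section OneShotCode.
Variable R : realType.
Local Notation C := (R[i]).

(** The case [e = 0] is reached by letting a positive bound decrease to [e]; it arises for zero
    eigenvalues. *)
Lemma retr_mulmx_le_ge0 m n (A : 'M[C]_(m, n)) (B : 'M[C]_(n, m)) (e : R) :
  0 <= e -> retr (A *m adj A) <= e ^+ 2 -> retr (B *m adj B) <= 1 ->
  `|retr (A *m B)| <= e.
Proof.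
move=> e0 hA hB; apply/ler_addgt0Pr => f f0.
apply: retr_mulmx_le => //; first by rewrite ltr_wpDl.
by apply: (le_trans hA); rewrite ler_sqr ?nnegrE ?lerDl ?addr_ge0 // ltW.
Qed.

Lemma retr_row_sandwich n (V M : 'M[C]_n) i :
  retr (row i V *m M *m adj (row i V)) = complex.Re ((V *m M *m adj V) i i).
Proof.
rewrite -row_mul; set VM := V *m M; rewrite /retr /mxtrace big_ord1 !mxE.
by congr complex.Re; apply: eq_bigr => j _; rewrite !adjE !mxE.
Qed.

(** One half of trace norm duality, without polar decomposition. An eigenbasis [v_i] of [A^* A] is
    inserted between [A] and [Z]; Cauchy-Schwarz bounds each term by [|A v_i|], the square root of
    the eigenvalue, times a norm at most 1, and these roots sum to the trace norm. *)
Lemma retr_mul_le_trnorm n (A Z : 'M[C]_n) : psd (1%:M - Z *m adj Z) ->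
  retr (A *m Z) <= trnorm A.
Proof.
move=> pZ; set B := adj A *m A; set V := spectralmx B.
have pB : psd B by have := psd_mulmx_adj (adj A); rewrite adjK.
have uV : unitary V by exact: spectral_unitary.
have hB : V *m B *m adj V = diag_mx (\row_i (spec B i)%:C%C).
  by rewrite [X in _ *m X *m _](hermitian_hdiag (psd_herm pB)) hdiag_conj.
rewrite /trnorm -/(retr _) mxfunE retr_hdiag //.
have -> : retr (A *m Z) = \sum_i retr ((A *m adj (row i V)) *m (row i V *m Z)).
  under eq_bigr => i _ do
    rewrite retrC mulmxA -(mulmxA (row i V)) retr_row_sandwich.
  rewrite -Re_sum -/(mxtrace _) -/(retr _) (retrC _ (adj V)) mulmxA (unitaryV uV) mul1mx.
  exact: retrC.
apply: ler_sum => i _; apply: (le_trans (ler_norm _)).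
apply: retr_mulmx_le_ge0; first exact: sqrtr_ge0.
- rewrite sqr_sqrtr ?spec_ge0 // retrC adjM adjK mulmxA -(mulmxA (row i V)).
  by rewrite -/B retr_row_sandwich hB !mxE eqxx mulr1n.
- rewrite adjM mulmxA -(mulmxA (row i V)) retr_row_sandwich.
  have := ge0_Re (psd_diag_ge0 i (psd_conjr V pZ)).
  rewrite mulmxBr mulmxBl mulmx1 uV !mxE eqxx.
  by rewrite ReD ReN subr_ge0.
Qed.

(** For traceless [A] the test [F] may be replaced by half of [2 F - 1], a contraction because
    [1 - (2 F - 1)^2 = 4 (F - F^2)]. This gives the factor 1/2. *)
Lemma retr_test_le_trnorm n (A F : 'M[C]_n) : psd F -> psd (1%:M - F) ->
  retr A = 0 -> retr (A *m F) <= trnorm A / 2.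
Proof.
move=> pF p1F A0.
have -> : retr (A *m F) = retr (A *m (F + F - 1%:M)) / 2.
  by rewrite mulmxBr mulmxDr mulmx1 retrB retrD A0; lra.
rewrite ler_pM2r ?invr_gt0 //; apply: retr_mul_le_trnorm.
have h := psdZ (ler0n R 4) (effect_sqr pF p1F).
rewrite (_ : _ - _ = 4%:R%:C%C *: (F - F *m F)) //.
rewrite adjB adjD adj_scalar1 (psd_herm pF) rmorph_nat.
rewrite !(mulmxBl, mulmxBr, mulmxDl, mulmxDr, mul1mx, mulmx1).
by apply/matrixP => i j; rewrite !mxE; ring.
Qed.

Lemma exists_le_mean (T : finType) (p f : T -> R) c : is_distr p ->
  \sum_x p x * f x <= c -> exists x, f x <= c.
Proof.
move=> [p0 p1] h; apply: contrapT => /forallNP nf.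
have f0 x : 0 <= p x * (f x - c).
  by rewrite mulr_ge0 // subr_ge0 ltW // ltNge; apply/negP/nf.
have s0 : \sum_x p x * (f x - c) = 0.
  apply/eqP; rewrite eq_le sumr_ge0 // andbT.
  under eq_bigr do rewrite mulrBr.
  by rewrite sumrB -mulr_suml p1 mul1r subr_le0.
have pz x : p x = 0.
  have /eqP : p x * (f x - c) = 0 by apply: (psumr_eq0P (fun x _ => f0 x) s0).
  rewrite mulf_eq0 subr_eq0 => /orP[/eqP //|/eqP fc].
  by case: (nf x); rewrite fc.
by move: p1; rewrite big1 // => /eqP; rewrite eq_sym oner_eq0.
Qed.

(* Gentle operator: disturbing [Pi] by the square root [G] of [1 - S] costs little
   on a state [W] that puts little weight on [S]. *)
Lemma gentle_test n (W Pi S G : 'M[C]_n) (z : R) : density W ->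
  psd Pi -> psd (1%:M - Pi) -> psd S -> psd G -> G *m G = 1%:M - S ->
  psd (G - (1%:M - S)) -> 0 < z -> retr (W *m S) <= z ^+ 2 ->
  retr (W *m Pi) - 2 * z <= retr (W *m (G *m Pi *m G)).
Proof.
move=> dW pPi p1Pi pS pG GG pGS z0 hS.
have pW := density_psd dW; have W1 := density_retr dW.
set F := 1%:M - G.
have aF : adj F = F by rewrite adjB adj_scalar1 (psd_herm pG).
(* The disturbance [F = 1 - G] is small on [W], since [S - F^2] is twice [G - (1 - S)], hence
   positive. *)
have FF : retr (W *m (F *m F)) <= z ^+ 2.
  apply: le_trans hS; apply: (retr_mul_le pW).
  have -> : S - F *m F = (G - (1%:M - S)) + (G - (1%:M - S)).
    rewrite !(mulmxBl, mulmxBr) mul1mx mulmx1 mul1mx GG.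
    by apply/matrixP => i j; rewrite !mxE; ring.
  exact: psdD.
have h1 : `|retr (W *m F *m Pi)| <= z.
  apply: retr_weighted_le; rewrite ?aF //.
  rewrite -W1 (psd_herm pPi); apply: (retr_mul_le_tr pW).
  exact: effect_sqr_le1.
have h2 : `|retr (W *m F *m (Pi *m G))| <= z.
  apply: retr_weighted_le; rewrite ?aF //.
  rewrite -W1; apply: (retr_mul_le_tr pW).
  have := psdD pS (psd_conj G (effect_sqr_le1 pPi p1Pi)).
  rewrite adjM (psd_herm pG) (psd_herm pPi) mulmxBr mulmxBl mulmx1 GG addrA.
  by rewrite (addrC S) subrK !mulmxA.
have h3 : retr (W *m F *m (Pi *m G)) = retr (W *m G *m Pi *m F).
  rewrite -retr_adj !adjM aF (psd_herm pG) (psd_herm pPi) (psd_herm pW).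
  by rewrite mulmxA retrC !mulmxA.
(* The change [Pi - G Pi G] equals [F Pi + G Pi F]; each of the two terms costs at most [z]. *)
have : retr (W *m Pi) - retr (W *m (G *m Pi *m G)) =
       retr (W *m F *m Pi) + retr (W *m G *m Pi *m F).
  rewrite -retrB -retrD; congr retr.
  rewrite !(mulmxBr, mulmxBl) !mulmx1 !mulmxA addrA subrK.
  by [].
rewrite -h3; move: h1 h2; rewrite !ler_norml => /andP[_ h1] /andP[_ h2].
by move: h1 h2; clear; lra.
Qed.

(** Let [S] be the sum of the operators chosen so far. Its trace is at most [K r], so on average the
    states put at most [2 eta] on [S], and [Pi x] misses at most [eta]: some [x] has total loss at
    most [3 eta <= z ^ 2]. Its operator is [G Pi G] with [G] the square root of [1 - S], which fits
    below [1 - S] and by the gentle operator bound still detects [W x]. *)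
Lemma greedy_code (T : finType) n (W Pi : T -> 'M[C]_n) (p : T -> R) (r q eta z : R) :
  is_distr p -> (forall x, density (W x)) ->
  (forall x, psd (Pi x)) -> (forall x, psd (1%:M - Pi x)) ->
  (forall x, retr (Pi x) <= r) -> 0 <= r -> 0 <= q -> 0 < z ->
  \sum_x p x * retr (W x *m (1%:M - Pi x)) <= eta ->
  (forall S, psd S -> psd (1%:M - S) ->
     \sum_x p x * retr (W x *m S) <= q * retr S + eta) ->
  3 * eta <= z ^+ 2 ->
  forall K : nat, q * (K%:R * r) <= eta ->
  exists (c : nat -> T) (E : nat -> 'M[C]_n),
    [/\ forall k, psd (E k), psd (1%:M - \sum_(k < K) E k) &
        forall k, (k < K)%N -> 1 - z ^+ 2 - 2 * z <= retr (W (c k) *m E k)].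
Proof.
move=> dp dW pPi p1Pi hr r0 q0 z0 hPi hS hz K hK.
(* The induction also carries the trace of the sum, which controls the mass that the sum
   captures. *)
suff [c [E []]] : exists (c : nat -> T) (E : nat -> 'M[C]_n),
    [/\ forall k, psd (E k), psd (1%:M - \sum_(k < K) E k),
        retr (\sum_(k < K) E k) <= K%:R * r &
        forall k, (k < K)%N -> 1 - z ^+ 2 - 2 * z <= retr (W (c k) *m E k)].
  by move=> *; exists c, E.
elim: K hK => [|K IH] hK.
  (* Codewords are a total function on [nat], so a default element is needed; one exists because [T]
     carries a distribution. *)
  have [x0 _] : exists x : T, (0 : R) <= 0.
    by apply: (@exists_le_mean _ p (fun=> 0)) => //; rewrite big1 // => *; rewrite mulr0.
  exists (fun=> x0), (fun=> 0); split=> //.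
  - by move=> _; apply: psd0.
  - by rewrite big_ord0 subr0; apply: psd1.
  - by rewrite big_ord0 retr0 mul0r.
have hK' : q * (K%:R * r) <= eta.
  apply: le_trans hK; rewrite ler_wpM2l // ler_wpM2r // ler_nat.
  exact: leqnSn.
have [c [E [pE pS hE hc]]] := IH hK'.
set S := \sum_(k < K) E k in pS hE.
have pS0 : psd S by apply: psd_sum.
have [x hx] : exists x, retr (W x *m S) + retr (W x *m (1%:M - Pi x)) <= z ^+ 2.
  apply: (exists_le_mean dp); apply: le_trans hz.
  under eq_bigr do rewrite mulrDr.
  rewrite big_split /=.
  have h1 := hS S pS0 pS; have h2 : q * retr S <= eta.
    by apply: le_trans hK'; rewrite ler_wpM2l.
  by move: h1 h2 hPi; clear; lra.
have pWx := density_psd (dW x).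
have ge1 := retr_mul_ge0 pWx pS0; have ge2 := retr_mul_ge0 pWx (p1Pi x).
have pSS : psd (1%:M - (1%:M - S)) by rewrite opprB addrC subrK.
have [G [pG GG pGS]] := effect_sqrt pS pSS.
have hmain : retr (W x *m Pi x) - 2 * z <= retr (W x *m (G *m Pi x *m G)).
  apply: (gentle_test (dW x) (pPi x) (p1Pi x) pS0 pG GG pGS z0).
  by move: hx ge2; clear; lra.
have aG := psd_herm pG.
exists (fun k => if (k < K)%N then c k else x),
       (fun k => if (k < K)%N then E k else G *m Pi x *m G).
have sE : \sum_(k < K.+1) (if (k < K)%N then E k else G *m Pi x *m G) =
          S + G *m Pi x *m G.
  rewrite big_ord_recr /= ltnn; congr (_ + _).
  by apply: eq_bigr => k _; rewrite ltn_ord.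
split.
- move=> k; case: ifP => _; first exact: pE.
  by have := psd_conj G (pPi x); rewrite aG.
- have := psd_conj G (p1Pi x).
  by rewrite aG mulmxBr mulmx1 mulmxBl GG -addrA -opprD -sE.
- rewrite sE retrD -natr1 mulrDl mul1r lerD //.
  apply: le_trans (hr x); rewrite retrC mulmxA retrC GG.
  exact: (retr_mul_le_tr (pPi x) pSS).
- move=> k; rewrite ltnS leq_eqVlt => /orP[/eqP ->|kK]; last first.
    by rewrite kK; apply: hc.
  rewrite ltnn; apply: le_trans hmain.
  move: hx; rewrite mulmxBr mulmx1 retrB (density_retr (dW x)).
  by move=> hx; move: ge1 hx; clear; lra.
Qed.

End OneShotCode.

(** * Packing and the resolvability lower bound *)

Section Packing.

(** Greedy packing: each chosen element discards its ball of at most [V] elements, so [m] choices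
    are possible in a set of more than [m V] elements. *)
Lemma exists_far_set (A : finType) (close : rel A) (V : nat) :
  symmetric close -> reflexive close ->
  (forall f, (#|[set g | close f g]| <= V)%N) ->
  forall m (S : {set A}), (m * V < #|S|)%N ->
  exists2 F : {set A}, F \subset S & #|F| = m /\
    {in F &, forall f g, f != g -> ~~ close f g}.
Proof.
move=> cS cR hV; elim=> [|m IH] S hS.
  exists finset.set0; first exact: finset.sub0set.
  by split=> [|f g]; rewrite ?cards0 // inE.
have /card_gt0P[f fS] : (0 < #|S|)%N by apply: leq_trans hS.
have [|F FS [cF hF]] := IH (S :\: [set g | close f g]).
  have := leq_trans (subset_leq_card (subsetIr S [set g | close f g])) (hV f).
  by have := cardsID [set g | close f g] S; rewrite mulSn in hS; lia.
have FS' g : g \in F -> g \in S /\ ~~ close f g.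
  by move=> /(fintype.subsetP FS); rewrite !inE => /andP[].
exists (f |: F).
  apply/fintype.subsetP => g; rewrite !inE => /orP[/eqP -> //|/FS'[]//].
split.
  rewrite cardsU1 cF (_ : f \notin F) //.
  by apply/negP => /FS'[_]; rewrite cR.
move=> g h; rewrite !inE => /orP[/eqP ->|gF] /orP[/eqP ->|hF'].
- by rewrite eqxx.
- by move=> _; case: (FS' _ hF').
- by move=> _; rewrite cS; case: (FS' _ gF).
- exact: hF.
Qed.

Lemma card_bigcup_le (I A : finType) (P : pred I) (F : I -> {set A}) :
  (#|\bigcup_(i | P i) F i| <= \sum_(i | P i) #|F i|)%N.
Proof.
elim/big_ind2: _ => [|A1 k1 A2 k2 h1 h2|//]; first by rewrite cards0.
exact: leq_trans (leq_card_setU _ _).1 (leq_add h1 h2).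
Qed.

Definition agree (L B : nat) (f g : {ffun 'I_L -> 'I_B}) := #|[set l | f l == g l]|.

(** An exponential moment of the number of agreements. It factorises over positions, and one
    position contributes [B] for the agreeing symbol and 1 for each other one, at most [2 B] in
    all. *)
Lemma sum_expn_agree L B (f : {ffun 'I_L -> 'I_B}) :
  (\sum_(g : {ffun 'I_L -> 'I_B}) B ^ agree f g <= (2 * B) ^ L)%N.
Proof.
have -> : (\sum_(g : {ffun 'I_L -> 'I_B}) B ^ agree f g =
           \sum_(g : {ffun 'I_L -> 'I_B}) \prod_l B ^ (f l == g l))%N.
  apply: eq_bigr => g _; rewrite -expn_sum /agree -sum1_card; congr (_ ^ _)%N.
  by rewrite big_mkcond; apply: eq_bigr => l _; rewrite inE; case: eqP.
rewrite -(bigA_distr_bigA (fun l b => B ^ (f l == b))%N).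
rewrite -[X in (_ <= _ ^ X)%N](card_ord L) -prod_nat_const.
apply: leq_prod => l _; rewrite (bigD1 (f l)) //= eqxx expn1 mul2n -addnn leq_add2l.
rewrite (eq_bigr (fun=> 1%N)); last by move=> b; rewrite eq_sym => /negbTE ->.
by rewrite sum1_card -[X in (_ <= X)%N](card_ord B) max_card.
Qed.

(** Markov's inequality for that moment: agreement on a fraction [1 / s] of the positions means
    weight at least [8 ^ L]. So a ball is at most a fraction [4 ^ - L] of all functions. *)
Lemma card_agree_ball L s (f : {ffun 'I_L -> 'I_(8 ^ s)}) :
  (#|[set g | (L <= s * agree f g)%N]| <= (2 * 8 ^ s) ^ L %/ 8 ^ L)%N.
Proof.
rewrite leq_divRL ?expn_gt0 //; apply: leq_trans (sum_expn_agree f).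
rewrite -sum_nat_const big_mkcond; apply: leq_sum => g _.
rewrite inE; case: ifP => // h; rewrite -expnM.
by rewrite leq_exp2l.
Qed.

End Packing.

(** * Counting M-types against functions on code positions *)

Section ResolvabilityLower.
Variable R : realType.
Local Notation C := (R[i]).

(** An M-type is the empirical distribution of a word of length [M], listing each [x] as often as
    [M q x] says. Hence M-types can be counted by words. *)
Lemma Mtype_counts (T : finType) (M : nat) (q : T -> R) :
  is_distr q -> (forall x, M%:R * q x \is a Num.int) ->
  exists t : M.-tuple T, forall x, M%:R * q x = (count_mem x t)%:R.
Proof.
move=> [q0 q1] qM.
have /choice[c hc] x : exists c : nat, M%:R * q x = c%:R.
  by apply/natrP; rewrite natrEint qM mulr_ge0.
pose s := flatten [seq nseq (c x) x | x <- enum T].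
have cs x : count_mem x s = c x.
  rewrite count_flatten -map_comp sumnE big_map big_enum (bigD1 x) //=.
  rewrite count_nseq /= eqxx mul1n big1 ?addn0 // => y yx.
  by rewrite count_nseq /= (negbTE yx).
have ss : size s == M.
  rewrite -(eqr_nat R) size_flatten /shape -map_comp sumnE big_map big_enum /=.
  under eq_bigr do rewrite size_nseq.
  rewrite natr_sum; under eq_bigr do rewrite -hc.
  by rewrite -mulr_sumr q1 mulr1.
by exists (Tuple ss) => x; rewrite hc cs.
Qed.

Lemma sum_count_mem (T : finType) (s : seq T) :
  (\sum_x count_mem x s = size s)%N.
Proof.
elim: s => [|y s IH]; first by rewrite big1.
under eq_bigr do rewrite /=.
rewrite big_split /= IH (bigD1 y) //= eqxx big1 ?addn0 // => x xy.
by rewrite eq_sym (negbTE xy).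
Qed.

Variables (T : finType) (n : nat) (W : T -> 'M[C]_n).
Hypothesis dW : forall x, density (W x).

Let mix (p : T -> R) : 'M[C]_n := \sum_x (p x)%:C%C *: W x.

Lemma retr_mix_mul p A : retr (mix p *m A) = \sum_x p x * retr (W x *m A).
Proof.
rewrite mulmx_suml retr_sum; apply: eq_bigr => x _.
by rewrite -scalemxAl retrZ.
Qed.

Lemma retr_mix p : is_distr p -> retr (mix p) = 1.
Proof.
move=> [_ p1]; rewrite -[mix p]mulmx1 retr_mix_mul -p1; apply: eq_bigr => x _.
by rewrite mulmx1 density_retr // mulr1.
Qed.

Lemma mix_psd p : is_distr p -> psd (mix p).
Proof. by move=> [p0 _]; apply: psd_sum => x _; apply/psdZ/density_psd. Qed.

(** The code has [L] positions with [8 ^ s] words each, and success probability at least [u]. The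
    number [m] is how many functions will share one M-type: by [hm], [m] disjoint tests, each of
    probability at least [(1 - m / s) u - eps], have total probability above 1. *)
Variables (M L s m : nat) (eps u : R).
Variables (c : 'I_L * 'I_(8 ^ s) -> T) (E : 'I_L * 'I_(8 ^ s) -> 'M[C]_n).
Hypotheses (M0 : (0 < M)%N) (L0 : (0 < L)%N) (s0 : (0 < s)%N) (u0 : 0 <= u).
Hypothesis pE : forall k, psd (E k).
Hypothesis p1E : psd (1%:M - \sum_k E k).
Hypothesis hE : forall k, u <= retr (W (c k) *m E k).
Hypothesis approx : forall p : T -> R, is_distr p -> exists2 q : T -> R,
  is_distr q /\ (forall x, M%:R * q x \is a Num.int) &
  trnorm (mix p - mix q) / 2 <= eps.
Hypothesis hm : 1 < m%:R * ((1 - m%:R / s%:R) * u - eps).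

Let fn := {ffun 'I_L -> 'I_(8 ^ s)}.
Let close (f g : fn) := (L <= s * agree f g)%N.
Let pf (f : fn) (x : T) : R := L%:R^-1 * \sum_l (x == c (l, f l))%:R.

Let pf_distr f : is_distr (pf f).
Proof.
split=> [x|]; first by rewrite mulr_ge0 ?invr_ge0 // sumr_ge0.
rewrite -mulr_sumr exchange_big /= (eq_bigr (fun=> 1)); last first.
  move=> l _; rewrite (bigD1 (c (l, f l))) //= eqxx big1 ?addr0 //.
  by move=> x /negbTE ->.
by rewrite sumr_const card_ord mulVf // pnatr_eq0 -lt0n.
Qed.

Let retr_pf f A :
  retr (mix (pf f) *m A) = L%:R^-1 * \sum_l retr (W (c (l, f l)) *m A).
Proof.
rewrite retr_mix_mul /pf; under eq_bigr do rewrite -mulrA mulr_suml.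
rewrite -mulr_sumr; congr (_ * _); rewrite exchange_big /=.
apply: eq_bigr => l _; rewrite (bigD1 (c (l, f l))) //= eqxx mul1r big1 ?addr0 //.
by move=> x /negbTE ->; rewrite mul0r.
Qed.

Let mixt (t : M.-tuple T) : 'M[C]_n := mix (fun x => (count_mem x t)%:R / M%:R).

Let mixt_distr (t : M.-tuple T) : is_distr (fun x => (count_mem x t)%:R / M%:R : R).
Proof.
split=> [x|]; first by rewrite divr_ge0.
rewrite -mulr_suml -natr_sum sum_count_mem size_tuple divff //.
by rewrite pnatr_eq0 -lt0n.
Qed.

Let exists_tuple f : exists t : M.-tuple T, forall F, psd F -> psd (1%:M - F) ->
  retr (mix (pf f) *m F) - eps <= retr (mixt t *m F).
Proof.
have [q [dq qM] hq] := approx (pf_distr f).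
have [t ht] := Mtype_counts dq qM; exists t => F pF p1F.
have -> : mixt t = mix q.
  apply: eq_bigr => x _; rewrite -ht mulrC mulKf //.
  by rewrite pnatr_eq0 -lt0n.
have h0 : retr (mix (pf f) - mix q) = 0.
  by rewrite retrB (retr_mix (pf_distr f)) (retr_mix dq) subrr.
have := retr_test_le_trnorm pF p1F h0.
by rewrite mulmxBl retrB => h; move: h hq; lra.
Qed.

(** A larger fiber would contain [m] functions agreeing pairwise on fewer than [L / s] positions.
    Their tests [F f] add up to at most 1 on [mixt t], yet each has the probability required by
    [hm]. *)
Let fiber_bound (t : M.-tuple T) (S : {set fn}) :
  (forall f, f \in S -> forall F, psd F -> psd (1%:M - F) ->
     retr (mix (pf f) *m F) - eps <= retr (mixt t *m F)) ->
  (#|S| <= m * ((2 * 8 ^ s) ^ L %/ 8 ^ L))%N.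
Proof.
move=> hS; rewrite leqNgt; apply/negP => hcard.
have cS : symmetric close.
  move=> f g; rewrite /close; congr (_ <= _ * _)%N; apply: eq_card => l.
  by rewrite !inE eq_sym.
have cR : reflexive close.
  move=> f; rewrite /close /agree (_ : [set _ | _] = finset.setT) ?cardsT ?card_ord ?leq_pmull //.
  by apply/setP => l; rewrite !inE eqxx.
have [A AS [cA hA]] := exists_far_set cS cR (@card_agree_ball L s) hcard.
(* A position is good for [f] if no other selected function has the same value there. Keeping only
   good positions makes the cells of distinct functions disjoint. *)
pose good (f : fn) l := [forall g in A, (g != f) ==> (g l != f l)].
pose cell (f : fn) (k : 'I_L * 'I_(8 ^ s)) := (k.2 == f k.1) && good f k.1.
pose F f : 'M[C]_n := \sum_(k | cell f k) E k.
have pF f : psd (F f) by apply: psd_sum => k _; apply: pE.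
have p1F f : psd (1%:M - F f).
  have pr : psd (\sum_(k | ~~ cell f k) E k) by apply: psd_sum => k _; apply: pE.
  have := psdD p1E pr; rewrite (bigID (cell f)) /= -/(F f).
  by rewrite opprD addrA subrK.
have pt := mix_psd (mixt_distr t).
have w0 k : 0 <= retr (mixt t *m E k) := retr_mul_ge0 pt (pE k).
have upper : \sum_(f in A) retr (mixt t *m F f) <= 1.
  have -> : 1 = retr (mixt t) by rewrite (retr_mix (mixt_distr t)).
  apply: le_trans (retr_mul_le_tr pt p1E).
  rewrite mulmx_sumr retr_sum.
  under eq_bigr do rewrite mulmx_sumr retr_sum big_mkcond.
  rewrite exchange_big /=; apply: ler_sum => k _.
  have [[f fA fk]|nf] := pselect (exists2 f, f \in A & cell f k).
    rewrite (bigD1 f) //= fk big1 ?addr0 // => g /andP[gA gf].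
    case: ifP => // /andP[/eqP gk _].
    case/andP: fk => /eqP fk /forall_inP/(_ g gA).
    by rewrite gf /= -gk -fk eqxx.
  rewrite big1 // => f fA; case: ifP => // fk.
  by case: nf; exists f.
have lower f : f \in A -> (1 - m%:R / s%:R) * u - eps <= retr (mixt t *m F f).
  move=> fA; apply: le_trans (hS f (fintype.subsetP AS f fA) (F f) (pF f) (p1F f)).
  rewrite lerD2r retr_pf.
  (* Bad positions lie in the union of the agreement sets with the other functions of [A], hence are
     at most a fraction [m / s] of all; the bound is stated without division. *)
  have ngood : (s * (L - #|[set l | good f l]|) <= m * L)%N.
    have -> : (L - #|[set l | good f l]| = #|~: [set l | good f l]|)%N.
      by rewrite [RHS]cardsCs finset.setCK card_ord.
    apply: (@leq_trans (s * \sum_(g in A | g != f) agree g f)).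
      rewrite leq_mul2l; apply/orP; right.
      apply: (@leq_trans #|\bigcup_(g in A | g != f) [set l | g l == f l]|).
        apply/subset_leq_card/fintype.subsetP => l; rewrite !inE negb_forall_in.
        move=> /exists_inP[g gA]; rewrite negb_imply negbK => /andP[gf gl].
        by apply/bigcupP; exists g; rewrite ?gA ?inE.
      exact: card_bigcup_le.
    rewrite big_distrr /= -cA -sum_nat_const big_mkcondr.
    apply: leq_sum => g gA; case: ifP => // gf.
    by have := hA g f gA fA gf; rewrite /close -ltnNge => /ltnW.
  have gl l : good f l -> u <= retr (W (c (l, f l)) *m F f).
    move=> gfl; apply: le_trans (hE (l, f l)) _.
    apply: (retr_mul_le (density_psd (dW _))).
    rewrite /F (bigD1 (l, f l)) /= ?/cell ?eqxx // addrC addrK.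
    by apply: psd_sum => k _; apply: pE.
  have hsum : #|[set l | good f l]|%:R * u <= \sum_l retr (W (c (l, f l)) *m F f).
    rewrite (bigID (good f)) /= -[X in X <= _]addr0; apply: lerD; last first.
      by apply: sumr_ge0 => l _; apply: (retr_mul_ge0 (density_psd (dW _)) (pF f)).
    rewrite cardsE mulr_natl -sumr_const; apply: ler_sum => l; exact: gl.
  have Lp : 0 < L%:R :> R by rewrite ltr0n.
  have sp : 0 < s%:R :> R by rewrite ltr0n.
  rewrite -(ler_pM2l Lp) mulVKf ?gt_eqF //; apply: le_trans hsum.
  rewrite mulrA; apply: ler_wpM2r => //.
  have gL : (#|[set l | good f l]| <= L)%N by rewrite -[X in (_ <= X)%N](card_ord L) max_card.
  move: ngood; rewrite -(ler_nat R) natrM natrB // natrM => h.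
  rewrite mulrBr mulr1 lerBlDr -lerBlDl.
  rewrite -(ler_pM2l sp); apply: le_trans h _.
  by rewrite [X in _ <= X](_ : _ = m%:R * L%:R) //; field; rewrite gt_eqF.
have : \sum_(f in A) ((1 - m%:R / s%:R) * u - eps) <= 1.
  by apply: le_trans upper; apply: ler_sum.
by rewrite sumr_const cA -[X in X <= _]mulr_natl leNgt hm.
Qed.

(** All [8 ^ (s L)] functions are distributed over [#|T| ^ M] words, and each fiber holds at most
    [m] times a ball, that is [m 8 ^ (s L) / 4 ^ L] functions. *)
Lemma expn4_le_Mtypes : (4 ^ L <= m * #|T| ^ M)%N.
Proof.
have /choice[phi hphi] := exists_tuple.
have cfn : (\sum_t #|[set f | phi f == t]| = (8 ^ s) ^ L)%N.
  rewrite -[RHS](_ : #|{: fn}| = _); last by rewrite card_ffun !card_ord.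
  rewrite -sum1_card (partition_big phi predT) //=.
  by apply: eq_bigr => t _; rewrite -sum1_card; apply: eq_bigl => f; rewrite inE.
have hle : ((8 ^ s) ^ L <= #|T| ^ M * (m * ((2 * 8 ^ s) ^ L %/ 8 ^ L)))%N.
  rewrite -cfn -[X in (_ <= X ^ _ * _)%N]/(#|T|) -card_tuple -sum_nat_const.
  apply: leq_sum => t _; apply: (@fiber_bound t) => f; rewrite inE => /eqP <-.
  exact: hphi.
have h8 : (8 ^ L * (8 ^ s) ^ L <= #|T| ^ M * m * (2 ^ L * (8 ^ s) ^ L))%N.
  apply: leq_trans (leq_mul (leqnn _) hle) _.
  rewrite -(expnMn 2); set Q := ((2 * _) ^ _)%N; set e := (8 ^ L)%N.
  rewrite (_ : (e * _ = #|T| ^ M * m * (Q %/ e * e))%N); last by ring.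
  by rewrite leq_mul2l leq_trunc_div orbT.
rewrite mulnA leq_pmul2r in h8; last by rewrite !expn_gt0.
have e8 : (8 ^ L = 4 ^ L * 2 ^ L)%N by rewrite -expnMn.
by rewrite e8 leq_pmul2r ?expn_gt0 // mulnC in h8.
Qed.

End ResolvabilityLower.

(** * Sampling and the one-shot identification bound *)

Section Covering.
Variable R : realType.
Local Notation C := (R[i]).

(** A derandomised variance computation: samples are added one by one, each chosen so that the
    squared deviation does not exceed its mean, which grows by at most [b] per step. *)
Lemma exists_sample (T J : finType) (p : T -> R) (Y : T -> J -> R) (b : R) (M : nat) :
  is_distr p -> (forall x, \sum_j Y x j ^+ 2 <= b) ->
  exists t : M.-tuple T,
    \sum_j (\sum_(x <- t) Y x j - M%:R * \sum_x p x * Y x j) ^+ 2 <= M%:R * b.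
Proof.
move=> dp hb; pose m j := \sum_x p x * Y x j; have [p0 p1] := dp.
elim: M => [|M [t ht]].
  exists [tuple]; rewrite big1 ?mul0r // => j _.
  by rewrite big_nil !mul0r subr0 expr0n.
pose S j := \sum_(x <- t) Y x j - M%:R * m j.
have [x hx] : exists x, \sum_j (S j - m j + Y x j) ^+ 2 <= M.+1%:R * b.
  apply: (exists_le_mean dp).
  (* The mean over the new sample: the cross term is [2 (S - m) m], so with the square of [S - m] it
     leaves [S^2 - m^2]. *)
  have -> : \sum_x p x * \sum_j (S j - m j + Y x j) ^+ 2 =
    \sum_j S j ^+ 2 - \sum_j m j ^+ 2 + \sum_x p x * \sum_j Y x j ^+ 2.
    under eq_bigr do rewrite mulr_sumr.
    under [X in _ = _ + X]eq_bigr do rewrite mulr_sumr.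
    rewrite exchange_big [X in _ = _ + X]exchange_big /= -sumrB -big_split /=.
    apply: eq_bigr => j _.
    transitivity (\sum_x (p x * (S j - m j) ^+ 2 +
        2 * (S j - m j) * (p x * Y x j) + p x * Y x j ^+ 2)).
      by apply: eq_bigr => x _; ring.
    rewrite !big_split /= -mulr_suml -mulr_sumr p1 -/(m j).
    by ring.
  have h1 : \sum_x p x * \sum_j Y x j ^+ 2 <= b.
    apply: (@le_trans _ _ (\sum_x p x * b)).
      by apply: ler_sum => x _; rewrite ler_wpM2l.
    by rewrite -mulr_suml p1 mul1r.
  have h2 : 0 <= \sum_j m j ^+ 2 by apply: sumr_ge0 => j _; apply: sqr_ge0.
  rewrite -natr1 mulrDl mul1r; move: h1 h2 ht; rewrite -/(m _) -/(S _); clear.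
  by rewrite /S /m; lra.
exists [tuple of x :: t]; apply: le_trans hx; apply: ler_sum => j _.
by rewrite big_cons -/(m j) /S -natr1 mulrDl mul1r le_eqVlt; apply/orP; left; apply/eqP; ring.
Qed.

(** The intended [Y x] is a truncated word state divided by the root of a reference state, and [Q z]
    is that root. It depends only on the class [z] (the type) of the word, so sums over a class can
    be formed before multiplying by [Q z]. *)
Variables (T Z : finType) (n : nat) (W Y : T -> 'M[C]_n) (Q : Z -> 'M[C]_n).
Variables (cls : T -> Z) (M : nat) (e1 e2 b : R).
Hypothesis M0 : (0 < M)%N.
Hypothesis e20 : 0 <= e2.
Hypothesis hb : b <= M%:R * e2 ^+ 2.
Hypothesis hW : forall x D, psd D -> psd (1%:M - D) ->
  `|retr (W x *m D) - retr (Y x *m Q (cls x) *m D)| <= e1.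
Hypothesis hY : forall x, retr (Y x *m adj (Y x)) <= b.
Hypothesis hQ : forall x D, psd D -> psd (1%:M - D) ->
  retr (Q (cls x) *m D *m adj (Q (cls x) *m D)) <= 1.

(** The real and imaginary entries of [Y x], sorted by class, form a real vector of squared length
    at most [b], to which [exists_sample] applies. In each class the deviation has Hilbert-Schmidt
    norm at most [e2], and Cauchy-Schwarz against [Q z D] then covers all tests [D] with one
    sample. *)
Lemma covering (p : T -> R) : is_distr p -> exists t : M.-tuple T,
  forall D, psd D -> psd (1%:M - D) ->
  `|\sum_x p x * retr (W x *m D) -
    M%:R^-1 * \sum_(x <- t) retr (Y x *m Q (cls x) *m D)| <= e1 + #|Z|%:R * e2.
Proof.
move=> dp; have [p0 p1] := dp.
pose part (c : bool) (w : C) := if c then complex.Re w else complex.Im w.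
have partD c : {morph part c : u v / u + v} by case: c => -[? ?] [? ?].
have part0 c : part c 0 = 0 by case: c.
have partZ c (k : R) w : part c (k%:C%C * w) = k * part c w.
  by case: c w => -[x y] /=; rewrite ?mul0r ?subr0 ?addr0.
pose Yc x (k : Z * ('I_n * 'I_n * bool)) :=
  if cls x == k.1 then part k.2.2 (Y x k.2.1.1 k.2.1.2) else 0.
have sumYc (A : 'M[C]_n) :
    \sum_(k : 'I_n * 'I_n * bool) part k.2 (A k.1.1 k.1.2) ^+ 2 = retr (A *m adj A).
  rewrite retr_mulmx_adj pair_big /=.
  rewrite -(pair_bigA _ (fun (k : 'I_n * 'I_n) c => part c (A k.1 k.2) ^+ 2)) /=.
  by apply: eq_bigr => k _; rewrite big_bool.
have hYc x : \sum_k Yc x k ^+ 2 <= b.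
  rewrite -(pair_bigA _ (fun z k => Yc x (z, k) ^+ 2)) /= (bigD1 (cls x)) //=.
  rewrite [X in _ + X]big1 ?addr0; last first.
    move=> z zx; rewrite big1 // => k _.
    by rewrite /Yc /= eq_sym (negbTE zx) expr0n.
  by apply: le_trans (hY x); rewrite -sumYc /Yc /= eqxx.
have [t ht] := exists_sample M dp hYc; exists t => D pD p1D.
have Mp : 0 < M%:R :> R by rewrite ltr0n.
pose A z : 'M[C]_n := (M%:R^-1)%:C%C *: (\sum_(x <- t | cls x == z) Y x) -
  \sum_(x | cls x == z) (p x)%:C%C *: Y x.
have partA z (k : 'I_n * 'I_n * bool) : part k.2 (A z k.1.1 k.1.2) =
    M%:R^-1 * (\sum_(x <- t) Yc x (z, k) - M%:R * \sum_x p x * Yc x (z, k)).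
  rewrite /A -[_ - _]/(_ + _) -scaleN1r.
  have -> : (-1 : C) = (-1 : R)%:C%C by rewrite rmorphN1.
  rewrite 3!mxE !summxE partD !partZ !(big_morph _ (partD _) (part0 _)).
  rewrite mulrBr mulKf ?gt_eqF // mulN1r; congr (_ * _ - _).
    by rewrite big_mkcond.
  rewrite big_mkcond; apply: eq_bigr => x _; rewrite /Yc /=.
  by case: eqP; rewrite ?mulr0 // mxE partZ.
have hA z : retr (A z *m adj (A z)) <= e2 ^+ 2.
  rewrite -sumYc; under eq_bigr do rewrite partA exprMn.
  rewrite -mulr_sumr exprVn mulrC ler_pdivrMr ?exprn_gt0 //.
  apply: (@le_trans _ _ (M%:R * b)); last first.
    have -> : e2 ^+ 2 * M%:R ^+ 2 = M%:R * (M%:R * e2 ^+ 2) by ring.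
    exact: (ler_wpM2l (ltW Mp) hb).
  apply: le_trans ht.
  rewrite -(pair_bigA _ (fun z k =>
    (\sum_(x <- t) Yc x (z, k) - M%:R * \sum_x p x * Yc x (z, k)) ^+ 2)) /=.
  rewrite (bigD1 z) //= lerDl; apply: sumr_ge0 => z' _; apply: sumr_ge0 => k _.
  exact: sqr_ge0.
have AQ z : `|retr (A z *m (Q z *m D))| <= e2.
  (* The bound on [Q z] is available only for classes that occur; in the others the deviation is
     0. *)
  have [[x <-]|nx] := pselect (exists x, cls x = z).
    by apply: retr_mulmx_le_ge0 => //; apply: hQ.
  have -> : A z = 0.
    rewrite /A !big1 ?scaler0 ?subrr // => x /eqP xz; case: nx; by exists x.
  by rewrite mul0mx retr0 normr0.
have sA : \sum_z retr (A z *m (Q z *m D)) =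
    M%:R^-1 * \sum_(x <- t) retr (Y x *m Q (cls x) *m D) -
    \sum_x p x * retr (Y x *m Q (cls x) *m D).
  have e z : retr (A z *m (Q z *m D)) =
      M%:R^-1 * \sum_(x <- t | cls x == z) retr (Y x *m Q (cls x) *m D) -
      \sum_(x | cls x == z) p x * retr (Y x *m Q (cls x) *m D).
    rewrite /A mulmxBl retrB -scalemxAl retrZ !mulmx_suml !retr_sum.
    congr (_ * _ - _); apply: eq_bigr => x /eqP <-; first by rewrite mulmxA.
    by rewrite -scalemxAl retrZ mulmxA.
  under eq_bigr do rewrite e.
  rewrite sumrB -mulr_sumr; congr (_ * _ - _).
    by rewrite [RHS](partition_big cls predT).
  by rewrite [RHS](partition_big cls predT).
set u := \sum_x p x * retr (W x *m D); set v := M%:R^-1 * _.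
pose w := \sum_x p x * retr (Y x *m Q (cls x) *m D).
have -> : u - v = (u - w) - (v - w) by ring.
apply: (le_trans (ler_normB _ _)); apply: lerD.
  rewrite /u /w -sumrB; apply: (le_trans (ler_norm_sum _ _ _)).
  apply: (@le_trans _ _ (\sum_x p x * e1)); last by rewrite -mulr_suml p1 mul1r.
  by apply: ler_sum => x _; rewrite -mulrBr normrM ger0_norm // ler_wpM2l // hW.
rewrite -sA; apply: (le_trans (ler_norm_sum _ _ _)).
apply: (@le_trans _ _ (\sum_(z : Z) e2)); first exact: ler_sum.
by rewrite sumr_const mulr_natl.
Qed.

(** The map from codewords to samples is injective: with a common sample, the test [D i] would have
    probabilities for [i] and [j] differing by at most [2 (e1 + #|Z| e2)], less than the gap
    [1 - l1 - l2] that the code guarantees. *)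
Lemma identification_bound (N : nat) (p : 'I_N -> T -> R) (D : 'I_N -> 'M[C]_n) l1 l2 :
  (forall i, is_distr (p i)) -> (forall i, psd (D i)) -> (forall i, psd (1%:M - D i)) ->
  (forall i, 1 - l1 <= \sum_x p i x * retr (W x *m D i)) ->
  (forall i j, i != j -> \sum_x p i x * retr (W x *m D j) <= l2) ->
  2 * (e1 + #|Z|%:R * e2) < 1 - l1 - l2 ->
  (N <= #|T| ^ M)%N.
Proof.
move=> dp pD p1D h1 h2 hlt.
have /choice[phi hphi] := fun i => covering (dp i).
suff inj : injective phi by have := leq_card phi inj; rewrite card_ord card_tuple.
move=> i j eij; apply/eqP; apply/negPn/negP => nij.
have hi := hphi i (D i) (pD i) (p1D i).
have hj := hphi j (D i) (pD i) (p1D i).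
rewrite -eij in hj.
have a := h1 i; have b' := h2 j i; rewrite eq_sym nij in b'; have {}b' := b' isT.
move: hi hj a b' hlt; rewrite !ler_norml => /andP[_ hi] /andP[hj _] a b' hlt.
by move: hi hj a b' hlt; lra.
Qed.

End Covering.

(** * Tail bounds for word states *)

Section Tails.
Variable R : realType.
Local Notation C := (R[i]).

(** From [expR u (1 - u) <= 1] and [(1 - u) (1 + u + 2 u^2) = 1 + u^2 (1 - 2 u)], which is at least
    1 for [u <= 1 / 2]. *)
Lemma expR_le_quadratic (u : R) : u <= 1 / 2 -> expR u <= 1 + u + 2 * u ^+ 2.
Proof.
move=> hu; have h1 : expR u * (1 - u) <= 1.
  rewrite -[leRHS](expRxMexpNx_1 u) ler_wpM2l ?expR_ge0 //.
  by have := expR_ge1Dx (- u).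
have h2 : 0 < 1 - u by lra.
rewrite -(ler_pM2r h2); apply: (le_trans h1).
have : 0 <= u ^+ 2 * (1 - 2 * u) by rewrite mulr_ge0 ?sqr_ge0 //; lra.
by move=> h; rewrite -subr_ge0; apply: le_trans h _; rewrite le_eqVlt; apply/orP; left;
  apply/eqP; ring.
Qed.

Lemma mgf_le (I : finType) (a g : I -> R) (s G : R) : is_distr a ->
  (forall i, a i != 0 -> `|g i| <= G) -> `|s| * G <= 1 / 2 ->
  \sum_i a i * expR (s * g i) <= expR (s * (\sum_i a i * g i) + 2 * s ^+ 2 * G ^+ 2).
Proof.
move=> [a0 a1] hg hs.
apply: (@le_trans _ _ (1 + (s * (\sum_i a i * g i) + 2 * s ^+ 2 * G ^+ 2)));
  last exact: expR_ge1Dx.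
apply: (@le_trans _ _ (\sum_i (a i + s * (a i * g i) + a i * (2 * s ^+ 2 * G ^+ 2)))).
  apply: ler_sum => i _.
  have [->|ai] := eqVneq (a i) 0; first by rewrite !(mul0r, mulr0) !addr0.
  have hsg : `|s * g i| <= 1 / 2.
    by apply: le_trans hs; rewrite normrM ler_wpM2l // hg.
  have h1 : expR (s * g i) <= 1 + s * g i + 2 * (s * g i) ^+ 2.
    by apply: expR_le_quadratic; apply: le_trans (ler_norm _) hsg.
  have h2 : (g i) ^+ 2 <= G ^+ 2.
    rewrite -(real_normK (num_real (g i))); apply: lerXn2r (hg i ai); rewrite nnegrE //.
    by apply: le_trans (hg i ai).
  apply: (@le_trans _ _ (a i * (1 + s * g i + 2 * s ^+ 2 * G ^+ 2))).
    rewrite ler_wpM2l //; apply: (le_trans h1); rewrite lerD2l exprMn mulrA.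
    by rewrite ler_wpM2l // mulr_ge0 // sqr_ge0.
  by rewrite le_eqVlt; apply/orP; left; apply/eqP; ring.
by rewrite !big_split /= a1 -mulr_sumr -mulr_suml a1 mul1r addrA.
Qed.

Lemma prod_le_expR (X : Type) (t : seq X) (f e : X -> R) :
  (forall x, 0 <= f x) -> (forall x, f x <= expR (e x)) ->
  \prod_(x <- t) f x <= expR (\sum_(x <- t) e x).
Proof.
move=> f0 fe; elim: t => [|x t IH]; first by rewrite !big_nil expR0.
rewrite !big_cons expRD ler_pM //.
by apply: prodr_ge0.
Qed.

(** The von Neumann entropy in nats; base 2 is restored only when passing to [mutinf] and to
    rates. *)
Definition entropy n (A : 'M[C]_n) : R := - \sum_j spec A j * ln (spec A j).

Lemma spec_distr n (A : 'M[C]_n) : density A -> is_distr (spec A).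
Proof.
move=> dA; split=> [i|]; first exact/spec_ge0/density_psd.
rewrite -(retr_hdiag _ (spectral_unitary A)) -hermitian_hdiag ?density_retr //.
exact/psd_herm/density_psd.
Qed.

Section Words.
Variables (X : finType) (d : nat).

Lemma sum_trow (r : X -> 'I_d -> R) n (t : n.-tuple X) :
  \sum_i trow r t i = \prod_(x <- t) \sum_j r x j.
Proof.
apply: (@complexI R); rewrite rmorph_sum rmorph_prod /=.
have := tens_word_tr (fun x => diag_mx (\row_i (r x i)%:C%C) : 'M[C]_d) t.
rewrite tens_word_diag mxtrace_diag => h.
transitivity (\sum_i (\row_i0 (trow r t i0)%:C%C : 'rV[C]_(d ^ n)) 0 i).
  by apply: eq_bigr => i _; rewrite mxE.
rewrite h; apply: eq_bigr => x _; rewrite mxtrace_diag rmorph_sum.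
by apply: eq_bigr => i _; rewrite mxE.
Qed.

Lemma sum_prod_tuple (f : X -> R) n :
  \sum_(t : n.-tuple X) \prod_(x <- t) f x = (\sum_x f x) ^+ n.
Proof.
elim: n => [|n IH].
  rewrite expr0 (bigD1 [tuple]) //= big_nil big1 ?addr0 // => t.
  by move=> /eqP[]; apply: tuple0.
rewrite exprS -IH mulr_suml; under eq_bigr do rewrite tuple_prodS.
rewrite (@sum_tupleS X R n (fun x t => f x * \prod_(y <- t) f y)).
by apply: eq_bigr => x _; rewrite -mulr_sumr.
Qed.

(** Chernoff bound: on [cond] the factor [expR (s * (ln w + b))] is at least 1, and its weighted sum
    factorises over the letters. The sign of [s] is free, which serves both tails. *)
Lemma word_tail (r : X -> 'I_d -> R) n (t : n.-tuple X) (cond : pred 'I_(d ^ n)) s b :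
  (forall x j, 0 <= r x j) ->
  (forall i, cond i -> 0 < trow r t i -> 0 <= s * (ln (trow r t i) + b)) ->
  \sum_(i | cond i) trow r t i <=
  expR (s * b) * \prod_(x <- t) \sum_j r x j * expR (s * ln (r x j)).
Proof.
move=> r0 hc; have t0 i := @trow_ge0 R X d r n t i r0.
rewrite -sum_trow mulr_sumr big_mkcond; apply: ler_sum => i _.
rewrite trow_powM //; case: ifP => ci; last by rewrite !mulr_ge0 ?expR_ge0.
have [->|ne] := eqVneq (trow r t i) 0; first by rewrite mul0r mulr0.
rewrite mulrCA -expRD -mulrDr ler_peMr //.
by rewrite -expR0 ler_expR [b + _]addrC; apply: hc; rewrite // lt0r ne t0.
Qed.

Variable (V : X -> 'M[C]_d).
Hypothesis dV : forall x, density (V x).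
Variable G : R.
Hypothesis hG : forall x j, `|ln (spec (V x) j)| <= G.

Let w x j := spec (V x) j.
Let w0 x j : 0 <= w x j := spec_ge0 j (density_psd (dV x)).

Lemma tens_word_spectral n (t : n.-tuple X) :
  tens_word V t = hdiag (tens_word (fun x => spectralmx (V x)) t) (trow w t).
Proof.
rewrite -tens_word_hdiag; apply: eq_tens_word => x.
exact/hermitian_hdiag/psd_herm/density_psd.
Qed.

Lemma spectral_word_unitary n (t : n.-tuple X) :
  unitary (tens_word (fun x => spectralmx (V x)) t).
Proof. by apply: tens_word_unitary => x; apply: spectral_unitary. Qed.

Lemma sum_trow_spec n (t : n.-tuple X) : \sum_i trow w t i = 1.
Proof.
by rewrite sum_trow big1 // => x _; have [] := spec_distr (dV x).
Qed.

Lemma upper_tail n (t : n.-tuple X) (s b : R) : 0 <= s -> s * G <= 1 / 2 ->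
  \sum_(i | expR (- b) < trow w t i) trow w t i <=
  expR (s * (b - \sum_(x <- t) entropy (V x)) + n%:R * (2 * s ^+ 2 * G ^+ 2)).
Proof.
move=> s0 sG.
have := @word_tail w n t (fun i => expR (- b) < trow w t i) s b w0.
move=> /(_ _)/le_trans; apply=> [i hi pi|].
  rewrite mulr_ge0 // -(opprK b) subr_ge0 -(expRK (- b)).
  by rewrite ler_ln ?posrE ?expR_gt0 // ltW.
rewrite mulrBr -addrA expRD ler_wpM2l ?expR_ge0 //.
apply: (@le_trans _ _ (expR (\sum_(x <- t) (- s * entropy (V x) + 2 * s ^+ 2 * G ^+ 2)))).
  apply: prod_le_expR => x.
    by apply: sumr_ge0 => j _; rewrite mulr_ge0 ?expR_ge0.
  rewrite /entropy mulrNN; apply: mgf_le; first exact: spec_distr.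
    by move=> j _; apply: hG.
  by rewrite ger0_norm.
rewrite ler_expR big_split /= -mulr_sumr mulNr lerD2l.
by rewrite big_const_seq count_predT size_tuple iter_addr_0 -[X in X <= _]mulr_natl.
Qed.

(** Here the word is random as well, so the moment generating function is taken under the joint law
    of a letter and an eigenvalue index, and the entropy appears averaged over [p]. *)
Lemma lower_tail (p : X -> R) n (s b : R) : is_distr p -> 0 <= s -> s * G <= 1 / 2 ->
  \sum_(t : n.-tuple X) (\prod_(x <- t) p x) *
     \sum_(i | trow w t i < expR (- b)) trow w t i <=
  expR (s * (n%:R * (\sum_x p x * entropy (V x)) - b) + n%:R * (2 * s ^+ 2 * G ^+ 2)).
Proof.
move=> [p0 p1] s0 sG.
pose f x := \sum_j w x j * expR (- s * ln (w x j)).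
apply: (@le_trans _ _ (\sum_(t : n.-tuple X)
    (\prod_(x <- t) p x) * (expR (- s * b) * \prod_(x <- t) f x))).
  apply: ler_sum => t _; rewrite ler_wpM2l ?prodr_ge0 //.
  apply: word_tail => // i hi pi.
  rewrite mulNr oppr_ge0 mulr_ge0_le0 // -(opprK b) subr_le0 -(expRK (- b)).
  by rewrite ler_ln ?posrE ?expR_gt0 // ltW.
have -> : \sum_(t : n.-tuple X)
    (\prod_(x <- t) p x) * (expR (- s * b) * \prod_(x <- t) f x) =
    expR (- s * b) * (\sum_x p x * f x) ^+ n.
  transitivity (expR (- s * b) * \sum_(t : n.-tuple X) \prod_(x <- t) (p x * f x)).
    by rewrite mulr_sumr; apply: eq_bigr => t _; rewrite big_split /= mulrCA.
  by rewrite sum_prod_tuple.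
have hf : \sum_x p x * f x <=
    expR (s * (\sum_x p x * entropy (V x)) + 2 * s ^+ 2 * G ^+ 2).
  have dpw : is_distr (fun k : X * 'I_d => p k.1 * w k.1 k.2).
    split=> [k|]; first by rewrite mulr_ge0 ?p0 ?w0.
    rewrite -(pair_bigA _ (fun x j => p x * w x j)) /= -p1; apply: eq_bigr => x _.
    by rewrite -mulr_sumr; have [_ ->] := spec_distr (dV x); rewrite mulr1.
  have := @mgf_le _ _ (fun k => ln (w k.1 k.2)) (- s) G dpw.
  rewrite -(pair_bigA _ (fun x j => p x * w x j * expR (- s * ln (w x j)))) /=.
  rewrite -(pair_bigA _ (fun x j => p x * w x j * ln (w x j))) /=.
  rewrite normrN sqrrN ger0_norm // => /(_ (fun k _ => hG _ _) sG).
  under eq_bigr do (under eq_bigr do rewrite -mulrA; rewrite -mulr_sumr).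
  under [X in - s * X]eq_bigr do (under eq_bigr do rewrite -mulrA; rewrite -mulr_sumr).
  move=> h; apply: (le_trans h); rewrite ler_expR lerD2r mulNr -mulrN -sumrN.
  by rewrite ler_wpM2l //; apply: ler_sum => x _; rewrite -mulrN.
apply: (@le_trans _ _ (expR (- s * b) *
    (expR (s * (\sum_x p x * entropy (V x)) + 2 * s ^+ 2 * G ^+ 2)) ^+ n)).
  rewrite ler_wpM2l ?expR_ge0 //; apply: lerXn2r; rewrite ?nnegrE ?expR_ge0 //.
  apply: sumr_ge0 => x _; rewrite mulr_ge0 ?p0 //; apply: sumr_ge0 => j _.
  by rewrite mulr_ge0 ?expR_ge0.
rewrite -expRM_natl -expRD ler_expR le_eqVlt; apply/orP; left; apply/eqP.
by rewrite -[_ *+ n]mulr_natl; ring.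
Qed.

End Words.
End Tails.

(** * Channel codes *)

Section ChannelCode.
Variable R : realType.
Local Notation C := (R[i]).

Lemma expRN_eventually_le (k e : R) : 0 < k -> 0 < e ->
  exists n0, forall n, (n0 <= n)%N -> expR (- (n%:R * k)) <= e.
Proof.
move=> k0 e0; exists (Num.bound (1 / (k * e))) => n hn.
have h : 1 / (k * e) <= n%:R.
  apply: le_trans (_ : (Num.bound (1 / (k * e)))%:R <= _); last by rewrite ler_nat.
  by apply/ltW/archi_boundP; rewrite divr_ge0 // mulr_ge0 // ltW.
rewrite expRN invf_ple ?posrE ?expR_gt0 //.
apply: (@le_trans _ _ (n%:R * k)); last first.
  by apply: le_trans (expR_ge1Dx _); rewrite lerDr.
have -> : e^-1 = 1 / (k * e) * k by field; rewrite !gt_eqF.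
by rewrite ler_pM2r.
Qed.

Lemma retr_hdiag_mul_le n (U S : 'M[C]_n) (r : 'I_n -> R) (c : R) :
  unitary U -> psd S -> (forall i, r i <= c) -> retr (hdiag U r *m S) <= c * retr S.
Proof.
move=> uU pS hr; rewrite retrC.
have := @retr_mul_le _ _ S (hdiag U r) (hdiag U (fun=> c)) pS.
rewrite hdiagB => /(_ (hdiag_psd _ _)) h.
apply: (le_trans (h _)); first by move=> i; rewrite subr_ge0.
have -> : hdiag U (fun=> c) = c%:C%C *: 1%:M.
  by rewrite -(hdiag1 uU) hdiagZ; apply: eq_hdiag => i; rewrite mulr1.
by rewrite -scalemxAr mulmx1 retrZ.
Qed.

Lemma hdiag_effect n (U : 'M[C]_n) (r : 'I_n -> R) : unitary U ->
  (forall i, 0 <= r i <= 1) -> psd (hdiag U r) /\ psd (1%:M - hdiag U r).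
Proof.
move=> uU hr; split; first by apply: hdiag_psd => i; have /andP[] := hr i.
rewrite -(hdiag1 uU) hdiagB; apply: hdiag_psd => i.
by have /andP[_] := hr i; rewrite subr_ge0.
Qed.

Variables (X : finType) (d : nat) (W : X -> 'M[C]_d).
Hypothesis dW : forall x, density (W x).

Lemma mixW_density p : is_distr p -> density (mixW W p).
Proof.
move=> [p0 p1]; split.
  by apply: psd_sum => x _; apply: psdZ (p0 x) (density_psd (dW x)).
rewrite /mixW raddf_sum /= (eq_bigr (fun x => (p x)%:C%C)) -?rmorph_sum ?p1 //.
by move=> x _; rewrite mxtraceZ density_tr // mulr1.
Qed.

Lemma prod_distr (p : X -> R) n : is_distr p ->
  is_distr (fun t : n.-tuple X => \prod_(x <- t) p x).
Proof.
move=> [p0 p1]; split=> [t|]; first by apply: prodr_ge0.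
by rewrite sum_prod_tuple p1 expr1n.
Qed.

Lemma mixWn_prod p n (t0 : n.-tuple X) :
  mixWn W (fun t : n.-tuple X => \prod_(x <- t) p x) = tens_word (fun=> mixW W p) t0.
Proof.
rewrite -(sum_tens_word (fun x => (p x)%:C%C *: W x) t0).
by apply: eq_bigr => t _; rewrite tens_wordZ.
Qed.

Lemma retr_mixWn n (p : n.-tuple X -> R) (A : 'M[C]_(d ^ n)) :
  retr (mixWn W p *m A) = \sum_t p t * retr (tens_word W t *m A).
Proof.
by rewrite mulmx_suml retr_sum; apply: eq_bigr => t _; rewrite -scalemxAl retrZ.
Qed.

(** The Holevo quantity in nats, a difference of entropies. *)
Definition mutinf_nat (p : X -> R) : R :=
  entropy (mixW W p) - \sum_x p x * entropy (W x).

(** The greedy code for the projections [Pi t] on the eigenvalues of the word state that are at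
    least [expR (- b)], so that their rank is at most [expR b]. The average state is a tensor power
    whose eigenvalues above [expR (- a)] carry little mass. *)
Lemma channel_code (p : X -> R) (eta z : R) : is_distr p -> 0 < eta <= 1 -> 0 < z ->
  exists n0, forall n, (n0 <= n)%N -> forall K : nat,
  K%:R <= z ^+ 2 / 3 * expR (n%:R * (mutinf_nat p - 2 * eta)) ->
  exists (c : nat -> n.-tuple X) (E : nat -> 'M[C]_(d ^ n)),
    [/\ forall k, psd (E k), psd (1%:M - \sum_(k < K) E k) &
        forall k, (k < K)%N -> 1 - z ^+ 2 - 2 * z <= retr (tens_word W (c k) *m E k)].
Proof.
move=> dp /andP[eta0 eta1] z0.
have [x0 _] : exists x : X, (0 : R) <= 0.
  by apply: (@exists_le_mean _ _ p (fun=> 0)) => //; rewrite big1 // => *; rewrite mulr0.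
set om := mixW W p; have dom : density om by exact: mixW_density.
pose G : R := 1 + \sum_x \sum_j `|ln (spec (W x) j)| + \sum_j `|ln (spec om j)|.
have G1 : 1 <= G.
  by rewrite /G -addrA lerDl addr_ge0 ?sumr_ge0 // => *; rewrite sumr_ge0.
have GW x j : `|ln (spec (W x) j)| <= G.
  rewrite /G (bigD1 x) //= (bigD1 j) //= -!addrA addrCA lerDl.
  by rewrite !addr_ge0 ?sumr_ge0 // => *; rewrite sumr_ge0.
have Gom (x : X) j : `|ln (spec om j)| <= G.
  rewrite /G (bigD1 j) //= addrCA lerDl.
  by rewrite !addr_ge0 ?sumr_ge0 // => *; rewrite sumr_ge0.
have G0 : 0 < G by apply: lt_le_trans G1.
(* This [s] minimises the tail exponent [2 s^2 G^2 - s eta]; the minimum is [- k]. *)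
pose s := eta / (4 * G ^+ 2).
have s0 : 0 <= s by rewrite divr_ge0 ?mulr_ge0 ?sqr_ge0 // ltW.
have sG : s * G <= 1 / 2.
  have -> : s * G = eta / (4 * G) by rewrite /s; field; rewrite gt_eqF.
  rewrite ler_pdivrMr ?mulr_gt0 //; lra.
pose k := eta ^+ 2 / (8 * G ^+ 2).
have k0 : 0 < k by rewrite divr_gt0 ?mulr_gt0 ?exprn_gt0.
have sk : 2 * s ^+ 2 * G ^+ 2 - s * eta = - k.
  by rewrite /s /k; field; rewrite gt_eqF.
have e0 : 0 < z ^+ 2 / 3 by rewrite divr_gt0 ?exprn_gt0.
have [n0 hn0] := expRN_eventually_le k0 e0.
exists n0 => n /hn0 hk K hK.
pose t0 := nseq_tuple n x0.
pose H := \sum_x p x * entropy (W x).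
pose b := n%:R * (H + eta); pose a := n%:R * (entropy om - eta).
pose U t := tens_word (fun x => spectralmx (W x)) (t : n.-tuple X).
pose w t := trow (fun x j => spec (W x) j) (t : n.-tuple X).
have uU t : unitary (U t) by exact: spectral_word_unitary.
have w0 t i : 0 <= w t i.
  by apply: trow_ge0 => x j; apply/spec_ge0/density_psd.
have w1 t : \sum_i w t i = 1 by exact: sum_trow_spec.
have Wt t : tens_word W t = hdiag (U t) (w t) by exact: tens_word_spectral.
pose Pi t := hdiag (U t) (fun i => (expR (- b) <= w t i)%R%:R).
have ePi t : psd (Pi t) /\ psd (1%:M - Pi t).
  by apply: hdiag_effect (uU t) _ => i; rewrite ler0n lern1 leq_b1.
apply: (@greedy_code R _ _ (@tens_word _ _ _ W n) Pi (fun t : n.-tuple X => \prod_(x <- t) p x)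
  (expR b) (expR (- a)) (z ^+ 2 / 3) z).
- exact: prod_distr.
- by move=> t; apply: tens_word_density.
- by move=> t; have [] := ePi t.
- by move=> t; have [] := ePi t.
- move=> t; rewrite retr_hdiag //.
  have -> : expR b = \sum_i expR b * w t i by rewrite -mulr_sumr w1 mulr1.
  apply: ler_sum => i _; case: (leP (expR (- b)) (w t i)) => h; rewrite ?mulr0n ?mulr1n.
    by rewrite -[leLHS](expRxMexpNx_1 b) ler_wpM2l // expR_ge0.
  by apply: mulr_ge0; [apply: expR_ge0|apply: w0].
- exact: expR_ge0.
- exact: expR_ge0.
- exact: z0.
- apply: le_trans hk.
  have -> : - (n%:R * k) = s * (n%:R * H - b) + n%:R * (2 * s ^+ 2 * G ^+ 2).
    by rewrite -mulrN -sk /b; ring.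
  apply: le_trans (lower_tail dW GW n b dp s0 sG).
  apply: ler_sum => t _; rewrite ler_wpM2l ?prodr_ge0 //; first by case: dp.
  rewrite -(hdiag1 (uU t)) hdiagB Wt hdiagM // retr_hdiag // [leRHS]big_mkcond.
  apply: ler_sum => i _; rewrite -/(w t i).
  by case: (ltP (w t i) (expR (- b))) => _; rewrite ?subr0 ?mulr1 ?subrr ?mulr0.
- move=> S pS p1S.
  rewrite -retr_mixWn (mixWn_prod _ t0).
  have dc (x : X) : density ((fun=> om) x) by [].
  rewrite -/om (tens_word_spectral dc t0).
  set U0 := tens_word _ t0; set la := trow _ t0.
  have uU0 : unitary U0 by apply: spectral_word_unitary.
  have la0 i : 0 <= la i by apply: trow_ge0 => x j; apply/spec_ge0/density_psd.
  (* The average state is split at [expR (- a)]: the small eigenvalues contribute at most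
     [expR (- a)] times the trace of [S], the large ones at most their total mass. *)
  have -> : hdiag U0 la = hdiag U0 (fun i => if la i <= expR (- a) then la i else 0) +
      hdiag U0 (fun i => if la i <= expR (- a) then 0 else la i).
    by rewrite hdiagD; apply: eq_hdiag => i; case: ifP; rewrite ?addr0 ?add0r.
  rewrite mulmxDl retrD; apply: lerD.
    apply: retr_hdiag_mul_le => // i.
    by case: ifP => // _; apply: expR_ge0.
  have pt : psd (hdiag U0 (fun i => if la i <= expR (- a) then 0 else la i)).
    by apply: hdiag_psd => i; case: ifP.
  apply: (le_trans (retr_mul_le_tr pt p1S)); apply: le_trans hk.
  have -> : - (n%:R * k) =
      s * (a - \sum_(x <- t0) entropy om) + n%:R * (2 * s ^+ 2 * G ^+ 2).
    rewrite -mulrN -sk /a big_const_seq count_predT size_tuple iter_addr_0.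
    by rewrite -[entropy om *+ n]mulr_natl; ring.
  apply: le_trans (upper_tail dc Gom t0 a s0 sG).
  rewrite retr_hdiag // [leRHS]big_mkcond; apply: ler_sum => i _.
  by rewrite -/(la i); case: (leP (la i) (expR (- a))).
- by rewrite mulrCA mulfV // mulr1.
- apply: (@le_trans _ _ (expR (- a) *
      (z ^+ 2 / 3 * expR (n%:R * (mutinf_nat p - 2 * eta)) * expR b))).
    by rewrite ler_wpM2l ?expR_ge0 // ler_wpM2r ?expR_ge0.
  set c := z ^+ 2 / 3; set v := n%:R * _.
  have -> : expR (- a) * (c * expR v * expR b) = c * expR (- a + v + b).
    by rewrite !expRD; ring.
  rewrite (_ : - a + v + b = 0) ?expR0 ?mulr1 //.
  by rewrite /v /mutinf_nat -/om -/H /a /b; ring.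
Qed.

End ChannelCode.

(** * Truncated word states *)

Lemma retr_palindrome (R : realType) n (A B : 'M[R[i]]_n) :
  retr (A *m B *m (B *m A)) = retr (A *m A *m (B *m B)).
Proof. by rewrite mulmxA retrC !mulmxA. Qed.

Section WordApproximation.
Variables (R : realType) (X : finType) (d : nat) (W : X -> 'M[R[i]]_d).
Local Notation C := (R[i]).
Hypothesis dW : forall x, density (W x).
Variables (V : 'M[C]_d) (mu : 'I_d -> R).
Hypothesis uV : unitary V.
Hypothesis mu0 : forall j, 0 < mu j.
Hypothesis mu1 : \sum_j mu j = 1.

Let u x j := complex.Re ((V *m W x *m adj V) j j).

(** This is [- Tr (W x ln sigma)] for the reference state [sigma] with eigenbasis [V] and
    eigenvalues [mu]. *)
Definition cross_entropy x : R := - \sum_j u x j * ln (mu j).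

Let u_distr x : is_distr (u x).
Proof.
have pW := density_psd (dW x); split=> [j|].
  exact/ge0_Re/psd_diag_ge0/psd_conjr.
have := tr_hdiag_psd V (fun=> 1) pW; rewrite hdiag1 // mul1mx density_tr //.
by move=> /(congr1 (@complex.Re R)) /= ->; apply: eq_bigr => j _; rewrite mul1r.
Qed.

Variable G : R.
Hypothesis GW : forall x j, `|ln (spec (W x) j)| <= G.
Hypothesis Gmu : forall j, `|ln (mu j)| <= G.
Variables (n : nat) (t : n.-tuple X) (eta s z : R).
Hypothesis s0 : 0 <= s.
Hypothesis sG : s * G <= 1 / 2.

Let Vt := tens_word (fun _ : X => V) t.
Let mt := trow (fun (_ : X) => mu) t.
Let Ut := tens_word (fun x => spectralmx (W x)) t.
Let wt := trow (fun x j => spec (W x) j) t.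
(** Kept are the eigenvalues of the power of [sigma] that are at least [expR (- a)] and those of the
    word state that are at most [expR (- b)]; [del] bounds the mass lost by either cut. *)
Let a := \sum_(x <- t) cross_entropy x + n%:R * eta.
Let b := \sum_(x <- t) entropy (W x) - n%:R * eta.
Let del := expR (n%:R * (2 * s ^+ 2 * G ^+ 2 - s * eta)).

Let uVt : unitary Vt. Proof. by apply: tens_word_unitary. Qed.
Let uUt : unitary Ut. Proof. exact: spectral_word_unitary. Qed.
Let mt0 i : 0 < mt i. Proof. by apply: trow_gt0. Qed.
Let wt0 i : 0 <= wt i.
Proof. by apply: trow_ge0 => x j; apply/spec_ge0/density_psd. Qed.
Let pWt : psd (tens_word W t).
Proof. by apply: tens_word_psd => x; apply: density_psd. Qed.
Let Wt1 : retr (tens_word W t) = 1.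
Proof. exact/density_retr/tens_word_density. Qed.

(** The projection is dominated by [expR (- s a)] times the power [- s] of the reference state,
    whose expectation in a product state factorises even though the two do not commute. *)
Lemma cross_tail :
  retr (tens_word W t *m hdiag Vt (fun i => (mt i < expR (- a))%R%:R)) <= del.
Proof.
pose r j := expR (- s * ln (mu j)).
apply: (@le_trans _ _ (retr (tens_word W t *m
    ((expR (- s * a))%:C%C *: tens_word (fun=> hdiag V r) t)))).
  apply: (retr_mul_le pWt).
  rewrite (tens_word_hdiag (fun=> V) (fun=> r)) hdiagZ hdiagB -/Vt.
  apply: hdiag_psd => i; rewrite subr_ge0 trow_pow // -/(mt i) -expRD -mulrDr.
  case: (ltP (mt i) (expR (- a))) => h; rewrite ?mulr1n ?mulr0n ?expR_ge0 //.
  rewrite -expR0 ler_expR mulNr oppr_ge0 mulr_ge0_le0 // addrC -(opprK a) subr_le0.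
  by rewrite -(expRK (- a)) ler_ln ?posrE ?expR_gt0 // ltW.
rewrite -scalemxAr retrZ tens_wordM /retr tens_word_tr.
have e x : \tr (W x *m hdiag V r) = (\sum_j u x j * r j)%:C%C.
  rewrite mxtrace_mulC tr_hdiag_psd; last exact: density_psd.
  by congr (_%:C)%C; apply: eq_bigr => j _; rewrite mulrC.
under eq_bigr do rewrite e.
rewrite -rmorph_prod /=.
apply: (@le_trans _ _ (expR (- s * a) *
    expR (\sum_(x <- t) (s * cross_entropy x + 2 * s ^+ 2 * G ^+ 2)))).
  rewrite ler_wpM2l ?expR_ge0 //; apply: prod_le_expR => x.
    by apply: sumr_ge0 => j _; rewrite mulr_ge0 ?expR_ge0 //; case: (u_distr x).
  rewrite /cross_entropy mulrN -mulNr -(sqrrN s); apply: mgf_le => //.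
  by rewrite normrN ger0_norm.
rewrite -expRD ler_expR big_split /= -mulr_sumr.
rewrite big_const_seq count_predT size_tuple iter_addr_0 -[X in _ + (_ + X)]mulr_natl.
by rewrite le_eqVlt; apply/orP; left; apply/eqP; rewrite /a; ring.
Qed.

Let wp i := if expR (- b) < wt i then 0 else wt i.
Let Wp := hdiag Ut wp.
Let h i := if mt i < expR (- a) then 0 else (Num.sqrt (mt i))^-1.

Let wp0 i : 0 <= wp i. Proof. by rewrite /wp; case: ifP. Qed.
Let pWp : psd Wp. Proof. exact: hdiag_psd. Qed.

(** The square root of the tensor power of [sigma]. In [word_trunc] the truncated word state is
    multiplied by the truncated inverse of this root, so its squared Hilbert-Schmidt norm is a norm
    weighted by [sigma^-1]. *)
Definition word_root : 'M[C]_(d ^ n) := hdiag Vt (fun i => Num.sqrt (mt i)).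
Definition word_trunc : 'M[C]_(d ^ n) := Wp *m hdiag Vt h.

Let Wt_spec : tens_word W t = hdiag Ut wt. Proof. exact: tens_word_spectral. Qed.

Let trunc_diff : psd (tens_word W t - Wp).
Proof.
rewrite Wt_spec hdiagB; apply: hdiag_psd => i; rewrite subr_ge0 /wp.
by case: ifP.
Qed.

Lemma retr_word_root_le D : psd D -> psd (1%:M - D) ->
  retr (word_root *m D *m adj (word_root *m D)) <= 1.
Proof.
move=> pD p1D; have aQ : adj word_root = word_root by exact: hdiag_herm.
have Q2 : word_root *m word_root = hdiag Vt mt.
  rewrite hdiagM //; apply: eq_hdiag => i; rewrite -expr2 sqr_sqrtr //.
  exact/ltW/mt0.
rewrite adjM aQ (psd_herm pD) retr_palindrome Q2.
have pm : psd (hdiag Vt mt) by apply: hdiag_psd => i; apply/ltW/mt0.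
apply: (le_trans (retr_mul_le_tr pm (effect_sqr_le1 pD p1D))).
rewrite retr_hdiag // sum_trow big1 // => x _; exact: mu1.
Qed.

(** The squared inverse root is at most [expR a] after its cut, and the truncated word state has
    squared norm at most [expR (- b)]. *)
Lemma retr_word_trunc_le : retr (word_trunc *m adj word_trunc) <= expR (a - b).
Proof.
rewrite /word_trunc adjM (hdiag_herm Vt) (psd_herm pWp) retr_palindrome retrC.
rewrite hdiagM // hdiagM //.
have pw2 : psd (hdiag Ut (fun i => wp i * wp i)).
  by apply: hdiag_psd => i; rewrite mulr_ge0.
apply: (@le_trans _ _ (expR a * retr (hdiag Ut (fun i => wp i * wp i)))).
  apply: retr_hdiag_mul_le => // i; rewrite /h.
  case: ltP => hi; first by rewrite mul0r expR_ge0.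
  rewrite -invfM -expr2 sqr_sqrtr ?(ltW (mt0 i)) //.
  by rewrite invf_ple ?posrE ?expR_gt0 // -expRN.
rewrite retr_hdiag // (expRD a (- b)) ler_wpM2l ?expR_ge0 //.
apply: (@le_trans _ _ (\sum_i expR (- b) * wt i)); last first.
  by rewrite -mulr_sumr sum_trow_spec // mulr1.
apply: ler_sum => i _; rewrite /wp; case: ltP => hi.
  by rewrite mul0r mulr_ge0 ?expR_ge0.
by rewrite ler_wpM2r.
Qed.

Hypotheses (z0 : 0 < z) (hz1 : del <= z) (hz2 : del <= z ^+ 2).

(** Cutting the word state in its own eigenbasis loses at most [del]. The cut in the eigenbasis of
    [sigma] acts on one side only and is bounded by Cauchy-Schwarz, hence by the root of [del]; this
    is why both [z] and [z ^ 2] must dominate [del]. *)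
Lemma word_trunc_approx D : psd D -> psd (1%:M - D) ->
  `|retr (tens_word W t *m D) - retr (word_trunc *m word_root *m D)| <= 2 * z.
Proof.
move=> pD p1D.
pose A := hdiag Vt (fun i => (mt i < expR (- a))%R%:R).
have hQ : hdiag Vt h *m word_root = 1%:M - A.
  rewrite hdiagM // -(hdiag1 uVt) hdiagB; apply: eq_hdiag => i; rewrite /h.
  case: ltP => hi; first by rewrite mul0r mulr1n subrr.
  by rewrite mulr0n subr0 mulVf // gt_eqF // sqrtr_gt0.
have -> : retr (tens_word W t *m D) - retr (word_trunc *m word_root *m D) =
    retr ((tens_word W t - Wp) *m D) + retr (Wp *m A *m D).
  rewrite -retrB -retrD; congr retr.
  rewrite /word_trunc -(mulmxA Wp) hQ mulmxBr mulmx1 !mulmxBl.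
  by rewrite opprB (addrC (Wp *m A *m D)) addrA.
apply: (le_trans (ler_normD _ _)).
have -> : 2 * z = z + z by ring.
apply: lerD.
  rewrite ger0_norm; last exact: retr_mul_ge0 trunc_diff pD.
  apply: (le_trans (retr_mul_le_tr trunc_diff p1D)); apply: le_trans hz1.
  rewrite Wt_spec hdiagB retr_hdiag //.
  have := upper_tail dW GW t b s0 sG.
  have -> : s * (b - \sum_(x <- t) entropy (W x)) + n%:R * (2 * s ^+ 2 * G ^+ 2) =
      n%:R * (2 * s ^+ 2 * G ^+ 2 - s * eta) by rewrite /b; ring.
  apply: le_trans; rewrite [leRHS]big_mkcond; apply: ler_sum => i _.
  by rewrite -/(wt i) /wp; case: ifP; rewrite ?subr0 ?subrr.
have AA : A *m adj A = A.
  rewrite hdiag_herm hdiagM //; apply: eq_hdiag => i.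
  by case: ltP; rewrite ?mulr1n ?mulr0n ?mulr1 ?mulr0.
have pA : psd A by apply: hdiag_psd => i; rewrite ler0n.
apply: (retr_weighted_le pWp z0).
  rewrite AA; apply: le_trans hz2; apply: le_trans cross_tail.
  by rewrite -subr_ge0 -retrB -mulmxBl; apply: retr_mul_ge0 trunc_diff pA.
rewrite (psd_herm pD).
apply: (le_trans (retr_mul_le_tr pWp (effect_sqr_le1 pD p1D))).
rewrite -Wt1 -subr_ge0 -retrB; exact: psd_retr_ge0 trunc_diff.
Qed.

End WordApproximation.

(** * Converse for identification *)

Section IdentificationConverse.
Variables (R : realType) (X : finType) (d : nat) (W : X -> 'M[R[i]]_d).
Local Notation C := (R[i]).
Hypothesis dW : forall x, density (W x).

Lemma tens_word_cst (A : 'M[C]_d) n (t t' : n.-tuple X) :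
  tens_word (fun=> A) t = tens_word (fun=> A) t'.
Proof. by elim: n t t' => [|n IH] t t' //=; rewrite (IH _ (behead_tuple t')). Qed.

Lemma trow_cst (r : 'I_d -> R) n (t t' : n.-tuple X) i :
  trow (fun=> r) t i = trow (fun=> r) t' i.
Proof. by elim: n t t' i => [|n IH] t t' i //=; rewrite (IH _ (behead_tuple t')). Qed.

(** Makes the root a function of the type alone, as the sampling bound requires of [Q]. *)
Lemma word_root_cst (V : 'M[C]_d) mu n (t t' : n.-tuple X) :
  word_root V mu t = word_root V mu t'.
Proof.
rewrite /word_root (tens_word_cst V t t'); apply: eq_hdiag => i.
by rewrite (trow_cst mu t t').
Qed.

Lemma sum_seq_count (s : seq X) (f : X -> R) :
  \sum_(x <- s) f x = \sum_y (count_mem y s)%:R * f y.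
Proof.
elim: s => [|x s IH]; first by rewrite big_nil big1 // => y _; rewrite mul0r.
rewrite big_cons IH; under [RHS]eq_bigr do rewrite /= natrD mulrDl.
rewrite big_split /=; congr (_ + _); rewrite (bigD1 x) //= eqxx mul1r big1 ?addr0 // => y yx.
by rewrite eq_sym (negbTE yx) mul0r.
Qed.

(** Eigenvalues of the mixture of [A] with the maximally mixed state: at least [tau / d], so their
    logarithms are bounded uniformly over all types. *)
Definition smoothed_spec (tau : R) (A : 'M[C]_d) j := (1 - tau) * spec A j + tau / d%:R.

(** Cross entropy is linear in the state, and the averaged state is diagonal in the basis used. *)
Lemma mean_cross_entropy (p : X -> R) mu : is_distr p ->
  \sum_x p x * cross_entropy W (spectralmx (mixW W p)) mu x =
  - \sum_j spec (mixW W p) j * ln (mu j).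
Proof.
move=> dp; set V := spectralmx _; rewrite /cross_entropy.
under eq_bigr do rewrite mulrN mulr_sumr.
rewrite sumrN exchange_big /=; congr (- _); apply: eq_bigr => j _.
under eq_bigr do rewrite mulrA.
rewrite -mulr_suml; congr (_ * _).
have dm := mixW_density dW dp.
have hV : V *m mixW W p *m adj V = diag_mx (\row_i (spec (mixW W p) i)%:C%C).
  rewrite [X in _ *m X *m _](hermitian_hdiag (psd_herm (density_psd dm))).
  by rewrite hdiag_conj //; apply: spectral_unitary.
have <- : complex.Re ((V *m mixW W p *m adj V) j j) = spec (mixW W p) j.
  by rewrite hV !mxE eqxx mulr1n.
rewrite /mixW mulmx_sumr mulmx_suml summxE Re_sum; apply: eq_bigr => x _.
by rewrite -scalemxAr -scalemxAl [X in _ = complex.Re X]mxE ReZ.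
Qed.

(** Words are classed by type, and the reference state of a type [P] is the smoothed [W(P)]. The
    exponent [a - b] is then [n] times cross entropy minus mean entropy plus [2 eta], which
    smoothing turns into at most the mutual information of [P] plus [3 eta]. *)
Lemma identification_converse (c l1 l2 eta : R) (x0 : X) :
  (forall p, is_distr p -> mutinf_nat W p <= c) -> 0 < eta <= 1 -> l1 + l2 < 1 ->
  exists n0, exists2 z : R, 0 < z & forall n, (n0 <= n)%N -> (0 < n)%N ->
  forall M : nat, (0 < M)%N ->
  expR (n%:R * (c + 3 * eta)) * (n.+1 ^ (2 * #|X|))%:R <= M%:R * z ^+ 2 ->
  forall N, idcode W n N l1 l2 -> (N <= (#|X| ^ n) ^ M)%N.
Proof.
move=> hc /andP[eta0 eta1] hl.
have d0 : (0 < d)%N.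
  rewrite lt0n; apply/negP => /eqP d0; have := density_retr (dW x0).
  rewrite /retr /mxtrace big1 => [/eqP|]; first by rewrite /= eq_sym oner_eq0.
  by move=> i; have := ltn_ord i; rewrite [X in (_ < X)%N]d0.
have dR : 0 < d%:R :> R by rewrite ltr0n.
(* With [1 - tau = expR (- eta)], smoothing lowers the logarithm of an eigenvalue by at most
   [eta]. *)
pose tau : R := 1 - expR (- eta).
have tau1 : 1 - tau = expR (- eta) by rewrite /tau; ring.
have tau0 : 0 < tau by rewrite subr_gt0 expR_lt1 oppr_lt0.
have td0 : 0 < tau / d%:R by rewrite divr_gt0.
pose G : R := 1 + \sum_x \sum_j `|ln (spec (W x) j)| + `|ln (tau / d%:R)|.
have sum0 : 0 <= \sum_x \sum_j `|ln (spec (W x) j)|.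
  by apply: sumr_ge0 => x _; apply: sumr_ge0.
have G1 : 1 <= G by rewrite /G -addrA lerDl addr_ge0.
have GW x j : `|ln (spec (W x) j)| <= G.
  rewrite /G (bigD1 x) //= (bigD1 j) //= -!addrA addrCA lerDl.
  by rewrite !addr_ge0 ?sumr_ge0 // => *; rewrite sumr_ge0.
have G0 : 0 < G by apply: lt_le_trans G1.
pose s := eta / (4 * G ^+ 2).
have s0 : 0 <= s by rewrite divr_ge0 ?mulr_ge0 ?sqr_ge0 // ltW.
have sG : s * G <= 1 / 2.
  have -> : s * G = eta / (4 * G) by rewrite /s; field; rewrite gt_eqF.
  rewrite ler_pdivrMr ?mulr_gt0 //; lra.
pose k := eta ^+ 2 / (8 * G ^+ 2).
have k0 : 0 < k by rewrite divr_gt0 ?mulr_gt0 ?exprn_gt0.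
have sk : 2 * s ^+ 2 * G ^+ 2 - s * eta = - k.
  by rewrite /s /k; field; rewrite gt_eqF.
(* The total error will be [2 (2 z + z) = 6 z], below the gap [7 z]. *)
pose z : R := (1 - l1 - l2) / 7.
have z0 : 0 < z by rewrite /z divr_gt0 //; lra.
have zm : 0 < Num.min z (z ^+ 2) by rewrite lt_min z0 exprn_gt0.
have [n0 hn0] := expRN_eventually_le k0 zm.
exists n0, z => // n /hn0; rewrite -mulrN -sk le_min => /andP[hz1 hz2] npos M M0 hM N.
have nR : 0 < n%:R :> R by rewrite ltr0n.
pose Z := {ffun X -> 'I_n.+1}.
pose cls (t : n.-tuple X) : Z := [ffun y => inord (count_mem y t)].
pose P (v : Z) (y : X) : R := (v y)%:R / n%:R.
have Pcls t y : P (cls t) y = (count_mem y t)%:R / n%:R.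
  by rewrite /P ffunE inordK // ltnS -[X in (_ <= X)%N](size_tuple t) count_size.
have dP t : is_distr (P (cls t)).
  split=> [y|]; first by rewrite Pcls divr_ge0.
  under eq_bigr do rewrite Pcls.
  by rewrite -mulr_suml -natr_sum sum_count_mem size_tuple divff // gt_eqF.
have sumP (t : n.-tuple X) (f : X -> R) : \sum_(x <- t) f x = n%:R * \sum_y P (cls t) y * f y.
  rewrite sum_seq_count mulr_sumr; apply: eq_bigr => y _; rewrite Pcls mulrA.
  by rewrite mulrCA divff ?gt_eqF // mulr1.
pose V v := spectralmx (mixW W (P v)).
pose mu v := smoothed_spec tau (mixW W (P v)).
have uV v : unitary (V v) by exact: spectral_unitary.
have dm t : density (mixW W (P (cls t))) := mixW_density dW (dP t).
have sp t := spec_distr (dm t).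
have mu_ge t j : tau / d%:R <= mu (cls t) j.
  by rewrite lerDr mulr_ge0 ?tau1 ?expR_ge0 //; case: (sp t).
have mu0 t j : 0 < mu (cls t) j by apply: lt_le_trans (mu_ge t j).
have mu1 t : \sum_j mu (cls t) j = 1.
  rewrite /mu /smoothed_spec big_split /= -mulr_sumr; case: (sp t) => _ ->.
  rewrite sumr_const card_ord -[_ *+ d]mulr_natl mulr1 mulrCA divff ?gt_eqF //.
  by rewrite mulr1 subrK.
have Gmu t j : `|ln (mu (cls t) j)| <= G.
  have h1 : mu (cls t) j <= 1.
    rewrite -(mu1 t) (bigD1 j) //= lerDl; apply: sumr_ge0 => i _; exact/ltW/mu0.
  have h2 : ln (mu (cls t) j) <= 0 by rewrite ln_le0.
  rewrite ler0_norm //; apply: (@le_trans _ _ (- ln (tau / d%:R))).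
    by rewrite lerN2 ler_ln ?posrE.
  by apply: (le_trans (ler_norm _)); rewrite normrN /G lerDr addr_ge0.
pose t0 := nseq_tuple n x0.
pose Q v := word_root (V v) (mu v) t0.
pose Y t := word_trunc W (V (cls t)) (mu (cls t)) t eta.
have cardZ : #|{: Z}| = (n.+1 ^ #|X|)%N by rewrite card_ffun card_ord.
have Zp : 0 < #|{: Z}|%:R :> R by rewrite ltr0n cardZ expn_gt0.
move=> [p [D [dp hD h1 h2]]].
rewrite -card_tuple.
(* The error [z / #|Z|] per class sums to [z]; squaring it turns the [(n + 1) ^ #|X|] types into the
   factor with exponent [2 #|X|]. *)
apply: (@identification_bound R _ Z _ (@tens_word _ _ _ W n) Y Q cls M (2 * z)
   (z / #|{: Z}|%:R) (expR (n%:R * (c + 3 * eta))) M0 _ _ _ _ _ N p D l1 l2).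
- by rewrite divr_ge0 // ltW.
- rewrite exprMn mulrA exprVn ler_pdivlMr ?exprn_gt0 //.
  by apply: le_trans hM; rewrite cardZ -natrX -expnM mulnC.
- move=> t E pE p1E; rewrite /Q (word_root_cst _ _ t0 t).
  exact: (word_trunc_approx dW (uV _) (mu0 t) GW (Gmu t) t s0 sG z0 hz1 hz2 pE p1E).
- move=> t; apply: (le_trans (retr_word_trunc_le dW (uV _) (mu0 t) t eta)).
  rewrite ler_expR !sumP (mean_cross_entropy _ (dP t)).
  set lam := spec _.
  have hmu : - \sum_j lam j * ln (mu (cls t) j) <= entropy (mixW W (P (cls t))) + eta.
    rewrite /entropy -/lam -[X in _ + X]mul1r -[X in _ + X * _](proj2 (sp t)) mulr_suml.
    rewrite -sumrN -sumrN -big_split /=; apply: ler_sum => j _; rewrite -/lam.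
    have lj0 : 0 <= lam j by case: (sp t).
    have [->|ljn] := eqVneq (lam j) 0; first by rewrite !mul0r oppr0 addr0.
    have lj : 0 < lam j by rewrite lt0r ljn.
    have h : ln (lam j) - eta <= ln (mu (cls t) j).
      rewrite -[X in _ + X](expRK (- eta)) -lnM ?posrE ?expR_gt0 //.
      rewrite ler_ln ?posrE ?mulr_gt0 ?expR_gt0 //.
      by rewrite /mu /smoothed_spec tau1 mulrC lerDl ltW.
    have := ler_wpM2l lj0 h; rewrite mulrBr; lra.
  have := hc _ (dP t); rewrite /mutinf_nat => hI.
  have -> : n%:R * - (\sum_j lam j * ln (mu (cls t) j)) + n%:R * eta -
      (n%:R * (\sum_y P (cls t) y * entropy (W y)) - n%:R * eta) =
      n%:R * (- (\sum_j lam j * ln (mu (cls t) j)) + 2 * eta -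
        \sum_y P (cls t) y * entropy (W y)) by ring.
  rewrite (ler_wpM2l (ltW nR)) //; move: hmu hI; clear; lra.
- move=> t E pE p1E; exact: (retr_word_root_le (uV _) (mu0 t) (mu1 t) t0 pE p1E).
- exact: dp.
- by move=> i; case: (hD i).
- by move=> i; case: (hD i).
- by move=> i; rewrite -retr_mixWn; apply: h1.
- by move=> i j ij; rewrite -retr_mixWn; apply: h2.
- rewrite [X in _ + X](_ : _ = z); last by rewrite mulrCA divff ?mulr1 // gt_eqF.
  have z7 : 1 - l1 - l2 = 7 * z by rewrite /z; field.
  by rewrite z7; move: z0; clear; lra.
Qed.

End IdentificationConverse.

(** * Mutual information and asymptotics *)

Section MutualInformation.
Variables (R : realType) (X : finType) (d : nat) (W : X -> 'M[R[i]]_d).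
Local Notation C := (R[i]).
Hypothesis dW : forall x, density (W x).

Lemma mulmx_adj_eq0 m n (A : 'M[C]_(m, n)) : retr (A *m adj A) = 0 -> A = 0.
Proof.
rewrite retr_mulmx_adj => h; apply/matrixP => i j; rewrite mxE.
have g0 i' j' : 0 <= complex.Re (A i' j') ^+ 2 + complex.Im (A i' j') ^+ 2.
  by rewrite addr_ge0 ?sqr_ge0.
have h1 : \sum_j (complex.Re (A i j) ^+ 2 + complex.Im (A i j) ^+ 2) = 0.
  by apply: (psumr_eq0P _ h) => // i' _; apply: sumr_ge0.
have : complex.Re (A i j) ^+ 2 + complex.Im (A i j) ^+ 2 = 0.
  by apply: (psumr_eq0P _ h1).
move=> /eqP; rewrite paddr_eq0 ?sqr_ge0 // !sqrf_eq0.
by case: (A i j) => a b /= /andP[/eqP -> /eqP ->].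
Qed.

(** A null vector of the mixture has zero expectation in each state of positive weight, and so is
    killed by its square root. This keeps the relative entropies in [mutinf] finite. *)
Lemma mixW_supp (p : X -> R) x : is_distr p -> 0 < p x -> supp_sub (W x) (mixW W p).
Proof.
move=> [p0 p1] px v hv.
have ge y : 0 <= retr (v *m W y *m adj v).
  rewrite /retr /mxtrace big_ord1; apply: ge0_Re.
  by have [_] := density_psd (dW y); apply.
have s0 : \sum_y p y * retr (v *m W y *m adj v) = 0.
  have := congr1 (fun u => retr (u *m adj v)) hv.
  rewrite mul0mx retr0 /mixW mulmx_sumr mulmx_suml retr_sum => h.
  by rewrite -[RHS]h; apply: eq_bigr => y _; rewrite -scalemxAr -scalemxAl retrZ.
have : p x * retr (v *m W x *m adj v) = 0.
  by apply: (psumr_eq0P _ s0) => // y _; rewrite mulr_ge0.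
move/eqP; rewrite mulf_eq0 (gt_eqF px) /= => /eqP.
have [Q pQ QW] := psd_sqrt (density_psd (dW x)).
rewrite -QW => hQ.
have vQ : v *m Q = 0.
  by apply: mulmx_adj_eq0; rewrite adjM (psd_herm pQ) mulmxA -(mulmxA v).
by rewrite mulmxA vQ mul0mx.
Qed.

Lemma retr_mul_log2 n (A : 'M[C]_n) : density A ->
  retr (A *m mxfun (@log2 R) A) = - entropy A / ln 2.
Proof.
move=> dA; rewrite mxfunE.
rewrite [X in X *m _](hermitian_hdiag (psd_herm (density_psd dA))).
rewrite hdiagM; last exact: spectral_unitary.
rewrite retr_hdiag; last exact: spectral_unitary.
rewrite /entropy opprK mulr_suml; apply: eq_bigr => i _.
by rewrite /log2 mulrA.
Qed.

(** Letters of weight 0 may have infinite relative entropy, but the product is 0 by convention; for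
    the others the logarithms of the mixture average to its entropy. *)
Lemma mutinfE (p : X -> R) : is_distr p -> mutinf W p = (mutinf_nat W p / ln 2)%:E.
Proof.
move=> dp; have [p0 p1] := dp.
pose val x := retr (W x *m (mxfun (@log2 R) (W x) - mxfun (@log2 R) (mixW W p))).
rewrite /mutinf (eq_bigr (fun x => (p x * val x)%:E)); last first.
  move=> x _; have [->|px] := eqVneq (p x) 0; first by rewrite mul0e mul0r.
  rewrite /relent asboolT //.
  by apply: mixW_supp => //; rewrite lt0r px p0.
rewrite sumEFin; congr EFin.
under eq_bigr do rewrite /val mulmxBr retrB mulrBr retr_mul_log2 //.
rewrite sumrB.
have -> : \sum_x p x * retr (W x *m mxfun (@log2 R) (mixW W p)) =
    - entropy (mixW W p) / ln 2.
  rewrite -retr_mul_log2; last exact: mixW_density.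
  rewrite {3}/mixW mulmx_suml retr_sum; apply: eq_bigr => x _.
  by rewrite -scalemxAl retrZ.
rewrite /mutinf_nat mulrBl mulNr opprK addrC; congr (_ + _).
rewrite mulr_suml -sumrN; apply: eq_bigr => x _.
by rewrite mulNr mulrN mulrA.
Qed.

End MutualInformation.

(** * Growth estimates, lower limits and logarithms *)

Section Asymptotics.
Variable R : realType.

(** Since [n + 1 <= (1 + 1 / del) expR (n del)], the [j]-th power costs at most half of the exponent
    for the chosen [del]; the other half absorbs the constants. *)
Lemma poly_le_expR (K e : R) (j : nat) : 0 < e ->
  exists n0, forall n, (n0 <= n)%N -> K * (n.+1 ^ j)%:R <= expR (n%:R * e).
Proof.
move=> e0; pose del := e / (2 * j.+1%:R).
have jp : 0 < j.+1%:R :> R by rewrite ltr0n.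
have del0 : 0 < del by rewrite divr_gt0 // mulr_gt0.
pose c : R := (1 + del^-1) ^+ j.
have c0 : 0 < c by rewrite exprn_gt0 // addr_gt0 // invr_gt0.
have K0 : 0 < `|K| * c + 1 by rewrite ltr_wpDl // mulr_ge0 // ltW.
have e2 : 0 < e / 2 by rewrite divr_gt0.
have Ki : 0 < (`|K| * c + 1)^-1 by rewrite invr_gt0.
have [n0 hn0] := expRN_eventually_le e2 Ki.
exists n0 => n /hn0; rewrite expRN lef_pV2 ?posrE ?expR_gt0 // => h.
have h1 : n.+1%:R <= (1 + del^-1) * expR (n%:R * del).
  have h2 := expR_ge1Dx (n%:R * del).
  have h3 : n%:R <= del^-1 * expR (n%:R * del).
    rewrite -(ler_pM2l del0) mulVKf ?gt_eqF // mulrC; apply: le_trans h2.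
    by rewrite lerDr.
  have h4 : 1 <= expR (n%:R * del).
    by apply: le_trans h2; rewrite lerDl mulr_ge0 // ltW.
  by rewrite -natr1 addrC mulrDl mul1r lerD.
have h5 : (n.+1 ^ j)%:R <= c * expR (n%:R * (e / 2)).
  rewrite natrX; apply: (@le_trans _ _ (((1 + del^-1) * expR (n%:R * del)) ^+ j)).
    apply: lerXn2r; rewrite ?nnegrE // mulr_ge0 ?expR_ge0 // addr_ge0 //.
    by rewrite invr_ge0 ltW.
  rewrite exprMn -/c ler_wpM2l ?(ltW c0) // -expRM_natl ler_expR.
  rewrite mulrCA ler_wpM2l //.
  have -> : j%:R * del = e / 2 * (j%:R / j.+1%:R).
    rewrite /del; have := gt_eqF jp; move: (j.+1%:R : R) => q q0; field.
    by rewrite q0.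
  by rewrite ler_piMr ?(ltW e2) // ler_pdivrMr // mul1r ler_nat.
apply: (@le_trans _ _ (`|K| * (n.+1 ^ j)%:R)).
  by rewrite ler_wpM2r // ler_norm.
apply: (@le_trans _ _ ((`|K| * c) * expR (n%:R * (e / 2)))).
  by rewrite -mulrA ler_wpM2l.
have -> : expR (n%:R * e) = expR (n%:R * (e / 2)) * expR (n%:R * (e / 2)).
  by rewrite -expRD -mulrDr -splitr.
rewrite ler_wpM2r ?expR_ge0 //.
by apply: le_trans h; rewrite lerDl.
Qed.

Lemma limn_einf_ge (u : nat -> \bar R) (x : \bar R) n0 :
  (forall n, (n0 <= n)%N -> (x <= u n)%E) -> (x <= limn_einf u)%E.
Proof.
move=> h; rewrite limn_einf_lim; apply: lime_ge; first exact: is_cvg_einfs.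
exists n0 => // n /= n0n; apply: le_ereal_inf_tmp => _ [k /= nk <-].
exact/h/(leq_trans n0n).
Qed.

Lemma limn_einf_le (u : nat -> \bar R) (x : \bar R) n0 :
  (forall n, (n0 <= n)%N -> (u n <= x)%E) -> (limn_einf u <= x)%E.
Proof.
move=> h; rewrite limn_einf_lim; apply: lime_le; first exact: is_cvg_einfs.
exists n0 => // n /= n0n; apply: le_trans (h n n0n).
by apply: ereal_inf_lbound; exists n => /=.
Qed.

Lemma ln2_gt0 : 0 < ln 2 :> R.
Proof. by apply: ln_gt0; rewrite ltr1n. Qed.

Lemma log2_expR (v : R) : log2 (expR v) = v / ln 2.
Proof. by rewrite /log2 expRK. Qed.

Lemma log2_le (x y : R) : 0 < x -> x <= y -> log2 x <= log2 y.
Proof.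
move=> x0 xy; rewrite /log2 ler_pM2r ?invr_gt0 ?ln2_gt0 // ler_ln ?posrE //.
exact: lt_le_trans xy.
Qed.

Lemma elog2_ge (r : R) (x : \bar R) : 0 < r -> (r%:E <= x -> (log2 r)%:E <= elog2 x)%E.
Proof.
move=> r0; case: x => [y| |] /=; [|by move=> _; rewrite leey|by rewrite leeNy_eq].
rewrite lee_fin => ry; rewrite (lt_le_trans r0 ry) lee_fin.
exact: log2_le.
Qed.

Lemma elog2_le (r : R) (x : \bar R) : 0 < r -> (x <= r%:E -> elog2 x <= (log2 r)%:E)%E.
Proof.
move=> r0; case: x => [y| |] /=; [|by rewrite leye_eq|by move=> _; rewrite leNye].
rewrite lee_fin => ry; case: ifP => y0; last by rewrite leNye.
by rewrite lee_fin; apply: log2_le.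
Qed.

End Asymptotics.

(** * Capacities *)

Section Capacities.
Variables (R : realType) (X : finType) (d : nat) (W : X -> 'M[R[i]]_d).
Local Notation C := (R[i]).
Hypothesis dW : forall x, density (W x).

(** The infimum over M-types need not be known to be attained; enlarging [eps] to [eps'] yields an
    actual [q]. *)
Lemma approx_err_le n M (eps eps' : R) : eps < eps' ->
  (approx_err W n M <= eps%:E)%E ->
  forall p : n.-tuple X -> R, is_distr p -> exists2 q : n.-tuple X -> R,
    is_distr q /\ (forall x, M%:R * q x \is a Num.int) &
    trnorm (mixWn W p - mixWn W q) / 2 <= eps'.
Proof.
move=> ee' h p dp.
have /ereal_inf_lt[_ [q [dq qM] <-]] : (ereal_inf
    [set ((trnorm (mixWn W p - mixWn W q)) / 2)%:E | q in [set q | is_Mtype M q]]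
    < eps'%:E)%E.
  apply: le_lt_trans (_ : (_ <= eps%:E)%E) _; last by rewrite lte_fin.
  by apply: le_trans h; apply: ereal_sup_ubound; exists p.
by rewrite lte_fin => /ltW ?; exists q.
Qed.

Lemma leq_expn2 a : (a <= 2 ^ a)%N.
Proof. exact/ltnW/ltn_expl. Qed.

(** The code has [L 8 ^ s] words with [L] as large as [channel_code] allows, and
    [4 ^ L <= m #|X| ^ (n M)] becomes linear after bounding by powers of 2. The constants [m], [s],
    [c] are independent of [n] and [M]. *)
Lemma resolvability_lower (p : X -> R) (eps eta : R) : is_distr p -> eps < 1 ->
  0 < eta <= 1 ->
  exists n0 m, exists2 c : R, 0 < c & forall n, (n0 <= n)%N -> forall M, (0 < M)%N ->
  (approx_err W n M <= eps%:E)%E ->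
  c * expR (n%:R * (mutinf_nat W p - 2 * eta)) <= (m + #|X| * (n * M)).+1%:R.
Proof.
move=> dp eps1 heta.
pose eps' := (eps + 1) / 2.
have ee' : eps < eps' by rewrite /eps'; lra.
pose g := 1 - eps'.
have g0 : 0 < g by rewrite /g /eps'; lra.
pose g1 := Num.min g 1.
have g10 : 0 < g1 by rewrite lt_min g0 ltr01.
have g1g : g1 <= g by rewrite ge_min lexx.
have g11 : g1 <= 1 by rewrite ge_min lexx orbT.
(* The choices give [u >= 1 - g1 / 4] and [m / s <= g1 / 4], so each test keeps probability at least
   [g1 / 2], and [m > 3 / g1] of them exceed 1. *)
pose z := g1 / 16.
have z0 : 0 < z by rewrite divr_gt0.
pose m := Num.bound (3 / g1).
have hm : 3 / g1 < m%:R by apply: archi_boundP; rewrite divr_ge0 // ltW.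
pose s := (Num.bound (4 * m%:R / g1)).+1.
have hs : 4 * m%:R / g1 < s%:R.
  apply: lt_trans (_ : (Num.bound (4 * m%:R / g1))%:R < _); last by rewrite ltr_nat.
  by apply: archi_boundP; rewrite divr_ge0 ?mulr_ge0 // ltW.
pose u : R := 1 - z ^+ 2 - 2 * z.
have u_ge : 1 - g1 / 4 <= u.
  have : z ^+ 2 <= z by rewrite expr2 ler_piMl ?ltW //; rewrite /z; move: g11; lra.
  by rewrite /u /z; move: g10; lra.
have sR : 0 < s%:R :> R by rewrite ltr0n.
have mR : 0 < m%:R :> R by apply: le_lt_trans hm; rewrite divr_ge0 // ltW.
have ms : m%:R / s%:R <= g1 / 4.
  rewrite ler_pdivrMr //; rewrite ltr_pdivrMr // in hs.
  by move: hs; rewrite mulrC => hs; move: (ltW hs); nra.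
have hmain : 1 < m%:R * ((1 - m%:R / s%:R) * u - eps').
  have h1 : (1 - g1 / 4) * (1 - g1 / 4) <= (1 - m%:R / s%:R) * u.
    by apply: ler_pM => //; move: g11 ms; lra.
  have h2 : g1 / 2 <= (1 - m%:R / s%:R) * u - eps'.
    have : 0 <= g1 ^+ 2 by exact: sqr_ge0.
    rewrite expr2; move: h1 g1g; rewrite /g; nra.
  apply: lt_le_trans (_ : m%:R * (g1 / 2) <= _); last by rewrite ler_wpM2l // ltW.
  by move: hm; rewrite ltr_pdivrMr //; lra.
have [n0 hn0] := channel_code dW dp heta z0.
exists n0, m, (z ^+ 2 / 3 / (8 ^ s)%:R).
  by rewrite !divr_gt0 ?exprn_gt0 // ltr0n expn_gt0.
move=> n /hn0 hcode M M0 herr.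
set I := expR _ in hcode *.
have I0 : 0 < I by exact: expR_gt0.
have e8 : 0 < (8 ^ s)%:R :> R by rewrite ltr0n expn_gt0.
pose y := z ^+ 2 / 3 / (8 ^ s)%:R * I.
have y0 : 0 <= y by rewrite mulr_ge0 ?divr_ge0 ?sqr_ge0 // ltW.
pose L := Num.truncn y.
have /andP[hL1 hL2] := truncn_itv y0.
apply: (le_trans (ltW hL2)); rewrite ler_nat ltnS -/L.
have [->|L0] := posnP L; first by [].
have hK : (L * 8 ^ s)%:R <= z ^+ 2 / 3 * I.
  rewrite natrM; apply: (@le_trans _ _ (y * (8 ^ s)%:R)).
    by rewrite ler_wpM2r // ltW.
  by rewrite /y mulrAC divfK // gt_eqF.
have [c [E [pE p1E hE]]] := hcode _ hK.
(* Pairs of a position and a symbol are flattened into code indices below [L * 8 ^ s]. *)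
have h4 := @expn4_le_Mtypes R _ _ (@tens_word _ _ _ W n)
  (fun x => tens_word_density x dW) M L s m eps' u
  (fun k => c (mxtens_index k)) (fun k => E (mxtens_index k)) M0 L0 isT.
have : (4 ^ L <= m * #|{: n.-tuple X}| ^ M)%N.
  apply: h4 => //.
  - by apply: le_trans u_ge; move: g11; lra.
  - rewrite (_ : \sum_k E (mxtens_index k) = \sum_(k < L * 8 ^ s) E k) //.
    rewrite [RHS](reindex (@mxtens_index L (8 ^ s))) //.
    by exists (@mxtens_unindex L (8 ^ s)) => k _; [apply: mxtens_indexK|apply: mxtens_unindexK].
  - by move=> k; apply: hE.
  - exact: approx_err_le ee' herr.
rewrite card_tuple -expnM => hfin.
have : (2 ^ L <= 2 ^ (m + #|X| * (n * M)))%N.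
  apply: (@leq_trans (4 ^ L)); first by rewrite leq_exp2r.
  apply: (leq_trans hfin); rewrite expnD leq_mul ?leq_expn2 //.
  by rewrite (expnM 2 #|X|); case: (n * M)%N => // e; rewrite leq_exp2r ?leq_expn2.
by rewrite leq_exp2l.
Qed.

(** The linear bound is at most a polynomial in [n] times [M], which costs one more [eta] in the
    exponent. The total loss [3 eta] then tends to 0. *)
Lemma capacity_le_Reps (eps : R) : eps < 1 -> (capacity W <= Reps W eps)%E.
Proof.
move=> eps1; apply: ge_ereal_sup => _ [p dp <-]; rewrite mutinfE //.
have key eta : 0 < eta <= 1 ->
    (((mutinf_nat W p - 3 * eta) / ln 2)%:E <= Reps W eps)%E.
  move=> heta; have /andP[eta0 _] := heta.
  have [n0 [m [c c0 hn0]]] := resolvability_lower dp eps1 heta.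
  have [n1 hn1] := poly_le_expR ((m + #|X|).+1%:R / c) 1 eta0.
  apply: (@limn_einf_ge R _ _ (maxn n0 n1).+1) => n hn.
  have n0n : (n0 <= n)%N by apply: leq_trans (ltnW hn); apply: leq_maxl.
  have n1n : (n1 <= n)%N by apply: leq_trans (ltnW hn); apply: leq_maxr.
  have npos : (0 < n)%N by apply: leq_trans hn.
  have nR : 0 < n%:R :> R by rewrite ltr0n.
  have hM : ((expR (n%:R * (mutinf_nat W p - 3 * eta)))%:E <= Meps W eps n)%E.
    apply: le_ereal_inf_tmp => _ [M [M0 hM] <-]; rewrite lee_fin.
    have h1 := hn0 n n0n M M0 hM.
    have h2 := hn1 n n1n; rewrite expn1 in h2.
    have h3 : ((m + #|X| * (n * M)).+1 <= (m + #|X|).+1 * (n.+1 * M))%N.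
      have : (0 < n * M)%N by rewrite muln_gt0 npos.
      nia.
    have h4 : c * expR (n%:R * (mutinf_nat W p - 2 * eta)) <=
        (m + #|X|).+1%:R * n.+1%:R * M%:R.
      by apply: (le_trans h1); rewrite -mulrA -!natrM ler_nat.
    have h5 : (m + #|X|).+1%:R * n.+1%:R <= c * expR (n%:R * eta).
      rewrite -ler_pdivrMl //; apply: le_trans h2; rewrite le_eqVlt.
      by apply/orP; left; apply/eqP; ring.
    have h6 : c * expR (n%:R * (mutinf_nat W p - 2 * eta)) <=
        c * expR (n%:R * eta) * M%:R.
      by apply: (le_trans h4); rewrite ler_wpM2r.
    rewrite -mulrA ler_pM2l // -ler_pdivrMl ?expR_gt0 // -expRN -expRD in h6.
    by apply: le_trans h6; rewrite ler_expR; nra.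
  have h := elog2_ge (expR_gt0 _) hM; rewrite log2_expR in h.
  have ni : (0 <= (n%:R^-1)%:E :> \bar R)%E by rewrite lee_fin invr_ge0.
  have := lee_wpmul2l ni h; apply: le_trans.
  by rewrite -EFinM lee_fin mulrA mulKf // gt_eqF.
case E : (Reps W eps) => [r| |]; rewrite ?leey //.
- rewrite lee_fin; apply/ler_addgt0Pr => e e0.
  pose eta := Num.min 1 (e * ln 2 / 3).
  have l2 := ln2_gt0 R.
  have el : 0 < e * ln 2 / 3 by rewrite divr_gt0 // mulr_gt0.
  have heta : 0 < eta <= 1 by rewrite lt_min ltr01 el ge_min lexx.
  have eta_e : eta <= e * ln 2 / 3 by rewrite ge_min lexx orbT.
  have := key eta heta; rewrite E lee_fin ler_pdivrMr // ler_pdivrMr // mulrDl.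
  by move: eta_e; clear; lra.
- by have := key 1; rewrite E ltr01 lexx leeNy_eq => /(_ isT).
Qed.

Lemma Reps_ge0 (eps : R) : (0 <= Reps W eps)%E.
Proof.
apply: (@limn_einf_ge R _ _ 0) => n _.
have hM : (1%:E <= Meps W eps n)%E.
  by apply: le_ereal_inf_tmp => _ [M [M0 _] <-]; rewrite lee_fin ler1n.
have := elog2_ge ltr01 hM; rewrite /log2 ln1 mul0r => h.
by apply: mule_ge0 => //; rewrite lee_fin invr_ge0.
Qed.

(** With the smallest [M] that the converse roughly permits, [log N] is at most [#|X| n M], so a
    second logarithm leaves the exponent of [M] up to polynomial factors. *)
Lemma idcap_le (c l1 l2 : R) (x0 : X) : 0 <= c ->
  (forall p, is_distr p -> mutinf_nat W p <= c) -> l1 + l2 < 1 ->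
  (idcap W l1 l2 <= (c / ln 2)%:E)%E.
Proof.
move=> c0 hc hl; have l2p := ln2_gt0 R.
have X0 : (0 < #|X|)%N by apply/card_gt0P; exists x0.
suff key eta : 0 < eta <= 1 -> (idcap W l1 l2 <= ((c + 4 * eta) / ln 2)%:E)%E.
  apply/lee_addgt0Pr => e e0; pose eta := Num.min 1 (e * ln 2 / 4).
  have el : 0 < e * ln 2 / 4 by rewrite divr_gt0 // mulr_gt0.
  have heta : 0 < eta <= 1 by rewrite lt_min ltr01 el ge_min lexx.
  have eta_e : eta <= e * ln 2 / 4 by rewrite ge_min lexx orbT.
  apply: (le_trans (key eta heta)); rewrite -EFinD lee_fin.
  rewrite mulrDl lerD2l ler_pdivrMr //.
  by move: eta_e; lra.
move=> heta; have /andP[eta0 _] := heta.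
have [n0 [z z0 hn0]] := identification_converse dW x0 hc heta hl.
pose j := (2 * #|X|)%N.
(* The constant allows for [#|X|] and for rounding [M] up; the exponent [j.+1] has one more factor
   [n + 1] to cover the block length in [n M]. *)
have [n1 hn1] := poly_le_expR (#|X|%:R * (z ^- 2 + 1)) j.+1 eta0.
apply: (@limn_einf_le R _ _ (maxn n0 n1).+1) => n hn.
have n0n : (n0 <= n)%N by apply: leq_trans (ltnW hn); apply: leq_maxl.
have n1n : (n1 <= n)%N by apply: leq_trans (ltnW hn); apply: leq_maxr.
have npos : (0 < n)%N by apply: leq_trans hn.
have nR : 0 < n%:R :> R by rewrite ltr0n.
set B := expR (n%:R * (c + 3 * eta)).
have B1 : 1 <= B.
  by rewrite -expR0 ler_expR mulr_ge0 // addr_ge0 // mulr_ge0 // ltW.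
pose y := B * (n.+1 ^ j)%:R / z ^+ 2.
have y0 : 0 <= y by rewrite divr_ge0 ?sqr_ge0 // mulr_ge0 // (le_trans _ B1).
pose M := (Num.truncn y).+1.
have /andP[hM1 hM2] := truncn_itv y0.
have hM : B * (n.+1 ^ j)%:R <= M%:R * z ^+ 2.
  by rewrite -ler_pdivrMr ?exprn_gt0 // ltW.
have hN N : idcode W n N l1 l2 -> (N <= 2 ^ (#|X| * (n * M)))%N.
  move=> hid; have := hn0 n n0n npos M (ltn0Sn _) hM N hid.
  move=> /leq_trans; apply; rewrite -expnM (expnM 2 #|X|) leq_exp2r ?leq_expn2 //.
  by rewrite muln_gt0 npos.
have Kp : (0 < #|X| * (n * M))%N by rewrite !muln_gt0 X0 npos.
have hNid : (Nid W n l1 l2 <= ((2 ^ (#|X| * (n * M)))%:R)%:E)%E.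
  by apply: ge_ereal_sup => _ [N hid <-]; rewrite lee_fin ler_nat hN.
have p2 : 0 < (2 ^ (#|X| * (n * M)))%:R :> R by rewrite ltr0n expn_gt0.
have h1 := elog2_le p2 hNid.
have e1 : log2 (2 ^ (#|X| * (n * M)))%:R = (#|X| * (n * M))%:R :> R.
  by rewrite /log2 natrX lnXn // -[ln 2 *+ _]mulr_natl mulfK // gt_eqF.
rewrite e1 in h1.
have hK : (#|X| * (n * M))%:R <= expR (n%:R * (c + 4 * eta)).
  have -> : n%:R * (c + 4 * eta) = n%:R * (c + 3 * eta) + n%:R * eta by ring.
  rewrite expRD -/B.
  apply: le_trans (ler_wpM2l (le_trans ler01 B1) (hn1 n n1n)).
  rewrite !natrM.
  have hMy : M%:R <= B * (n.+1 ^ j)%:R * (z ^- 2 + 1).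
    rewrite /M -natr1 mulrDr mulr1; apply: lerD => //.
    by apply: mulr_ege1 => //; rewrite ler1n expn_gt0.
  have hn' : n%:R <= n.+1%:R :> R by rewrite ler_nat.
  have -> : B * (#|X|%:R * (z ^- 2 + 1) * (n.+1 ^ j.+1)%:R) =
      #|X|%:R * (n.+1%:R * (B * (n.+1 ^ j)%:R * (z ^- 2 + 1))).
    by rewrite expnS natrM; ring.
  by rewrite ler_wpM2l // ler_pM.
have Kr : ((#|X| * (n * M))%:R%:E <= (expR (n%:R * (c + 4 * eta)))%:E :> \bar R)%E.
  by rewrite lee_fin.
have h2 := elog2_le (expR_gt0 _) (le_trans h1 Kr); rewrite log2_expR in h2.
have ni : (0 <= (n%:R^-1)%:E :> \bar R)%E by rewrite lee_fin invr_ge0.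
have := lee_wpmul2l ni h2 => /le_trans; apply.
by rewrite -EFinM lee_fin mulrA mulKf // gt_eqF.
Qed.

(** Over an empty alphabet there is no word of positive length, hence no input distribution, so only
    [N = 0] is possible. *)
Lemma idcap_le_empty (l1 l2 : R) : (X -> False) -> (idcap W l1 l2 <= 0)%E.
Proof.
move=> nX; apply: (@limn_einf_le R _ _ 1) => n npos.
have hN : (Nid W n l1 l2 <= 1%:E)%E.
  apply: ge_ereal_sup => _ [N hid <-]; rewrite lee_fin lern1.
  case: N hid => // N [p [D [dp _ _ _]]].
  have [_] := dp ord0; rewrite big1 => [/eqP|t _]; first by rewrite eq_sym oner_eq0.
  by case: (nX (tnth t (Ordinal npos))).
have h1 := elog2_le ltr01 hN; rewrite /log2 ln1 mul0r in h1.
have h2 := elog2_le ltr01 (le_trans h1 lee01); rewrite /log2 ln1 mul0r in h2.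
by apply: mule_ge0_le0 => //; rewrite lee_fin invr_ge0.
Qed.

End Capacities.

Theorem theorem5 (R : realType) (X : finType) (d : nat) (W : X -> 'M[R[i]]_d) :
  (forall x, density (W x)) ->
  (forall l1 l2 eps : R, 0 < l1 < 1 -> 0 < l2 < 1 -> 0 < eps ->
     eps < 1 - l1 - l2 -> (idcap W l1 l2 <= Reps W eps)%E) /\
  (forall eps : R, 0 < eps < 1 -> (capacity W <= Reps W eps)%E).
Proof.
move=> dW; split=> [l1 l2 eps /andP[l10 _] /andP[l20 _] eps0 heps|eps /andP[_ eps1]];
  last exact: capacity_le_Reps.
have eps1 : eps < 1 by lra.
have hl : l1 + l2 < 1 by lra.
have C_le := capacity_le_Reps dW eps1; have R0 := Reps_ge0 W eps.
(* The bound on [idcap] needs a letter; the empty alphabet is settled by [Reps_ge0]. *)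
have [[x0 _]|nX] := pselect (exists x : X, True); last first.
  apply: (le_trans _ R0); apply: idcap_le_empty => x.
  by case: nX; exists x.
have mutinf_le p : is_distr p -> ((mutinf_nat W p / ln 2)%:E <= capacity W)%E.
  by move=> dp; rewrite -mutinfE //; apply: ereal_sup_ubound; exists p.
have l2p := ln2_gt0 R.
case E : (capacity W) C_le mutinf_le => [c| |] C_le mutinf_le.
(* The maximum with 0 supplies the nonnegative bound that [idcap_le] asks for; if it is 0,
   nonnegativity of [Reps] concludes. *)
- have hc p : is_distr p -> mutinf_nat W p <= Num.max 0 (c * ln 2).
    move=> /mutinf_le; rewrite lee_fin ler_pdivrMr // => h.
    by rewrite le_max h orbT.
  apply: (le_trans (idcap_le dW x0 _ hc hl)); first by rewrite le_max lexx.
  rewrite /Num.max; case: ifP => _; last by rewrite mul0r.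
  by rewrite mulfK ?gt_eqF.
- by move: C_le; rewrite leye_eq => /eqP ->; rewrite leey.
- have hc p : is_distr p -> mutinf_nat W p <= 0 by move=> /mutinf_le; rewrite leeNy_eq.
  by apply: (le_trans (idcap_le dW x0 (lexx _) hc hl)); rewrite mul0r.
Qed.
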